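(* Let $d\ge1$, $\rho>0$, and let $W:\mathbb R^d\to[0,+\infty)$ and $K$ satisfy (W) and (K) of the context, and let $W(\gamma(x))=W(x)$ for all $x\in\mathbb R^d$, where $\gamma:\mathbb R^d\to\mathbb R^d$ is a reflection. Then the problem $$\min_{m\in\mathcal P_{2,\rho}^r(\mathbb R^d)}\mathcal W(m),\qquad \mathcal W(m)=\int_{\mathbb R^d}W(x)\,m(dx)-\int_{\mathbb R^d}\int_{\mathbb R^d}K(|x-y|)\,m(dx)\,m(dy),$$ admits at least one solution. Each solution is given by $\rho\chi_E$ for some measurable set $E\subseteq\mathbb R^d$ with $|E|=\rho^{-1}$. Moreover, if $\rho\chi_E$ is a minimizer, then $\rho\chi_{\gamma E}$ is also a minimizer.
   Context: $\mathcal P_2(\mathbb R^d)$ is the set of Borel probability measures with finite second moment; $\mathcal P_{2,\rho}^r(\mathbb R^d)$ is the set of $m\in\mathcal P_2(\mathbb R^d)$ having a density $\tilde m$ with $0\le\tilde m\le\rho$ a.e. ($m$ is identified with its density). $\chi_E$ is the characteristic function of $E$. $\gamma$ is a reflection across a hyperplane. (W): $W\in C(\mathbb R^d)$ is non-negative; there is $C>0$ with $C^{-1}|x|^2-C\le W(x)\le C|x|^2+C$; there are $a^+,a^-\in\mathbb R^d$ and $\tilde r>0$ such that the (closed) balls $B(a^+,\tilde r)$, $B(a^-,\tilde r)$ are disjoint and $W(x)=0\iff x\in B(a^+,\tilde r)\cup B(a^-,\tilde r)$. (K): $K:(0,+\infty)\to[0,+\infty)$ is such that $r\mapsto r^{d-1}K(r)$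 is in $L^1_{\rm loc}([0,+\infty))$; $K$ is nonincreasing; $\lim_{r\to0^+}\left(K(r)-K(t+r)\right)>0$ (possibly $+\infty$) for every $t>0$; $\lim_{r\to+\infty}K(r)=0$. *)

(* Defs.v *)
From HB Require Import structures.
From mathcomp Require Import all_boot all_order all_algebra.
From mathcomp Require Import all_classical all_reals all_analysis measurable_realfun.
From mathcomp Require Import lra.

Set Implicit Arguments.
Unset Strict Implicit.
Unset Printing Implicit Defensive.

Import Order.TTheory GRing.Theory Num.Theory.
Import numFieldNormedType.Exports.

Local Open Scope classical_set_scope.
Local Open Scope ring_scope.

(* R^d with its Borel sigma-algebra.  The type is convertible to 'rV[R]_d, so
   the vector-space and (product) topological structures remain available. *)
Definition Rd (R : realType) (d : nat) : measurableType _ :=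
  g_sigma_algebraType (@open 'rV[R]_d).

(* 'rV[R]_d is normed by the sup norm in the library, whence the next two
   definitions. *)
Definition dot (R : realType) (d : nat) (x y : 'rV[R]_d) : R :=
  \sum_(i < d) x 0 i * y 0 i.

Definition enorm (R : realType) (d : nat) (x : 'rV[R]_d) : R :=
  Num.sqrt (dot x x).

Definition eball (R : realType) (d : nat) (a : 'rV[R]_d) (r : R) :
  set 'rV[R]_d := [set x | enorm (x - a) <= r].

Lemma measurable_coord (R : realType) (d : nat) (i : 'I_d) :
  measurable_fun [set: Rd R d] (fun v : Rd R d => (v : 'rV[R]_d) 0 i).
Proof.
apply: (measurability _ (RGenOpens.measurableE R)).
move=> _ [_ [a [b ->] <-]]; rewrite setTI; apply: sub_sigma_algebra.
move/continuousP : (@coord_continuous R 1 d 0 i); apply; exact: interval_open.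
Qed.

Lemma measurable_rV (R : realType) (d : nat) d' (T : measurableType d')
    (f : T -> Rd R d) :
  (forall i, measurable_fun [set: T] (fun t => (f t : 'rV[R]_d) 0 i)) ->
  measurable_fun [set: T] f.
Proof.
move=> mf; apply: (@measurability _ _ T (Rd R d) setT f (@open 'rV[R]_d) erefl).
move=> _ [U oU <-]; rewrite setTI.
pose box (q : 'rV[rat]_d * rat) : set 'rV[R]_d :=
  [set v | forall i, ball (ratr (q.1 0 i) : R) (ratr q.2) (v 0 i)].
pose F n : set T := if @unpickle ('rV[rat]_d * rat)%type n is Some q then
  if `[< box q `<=` U >] then f @^-1` box q else set0 else set0.
suff -> : f @^-1` U = \bigcup_n F n.
  apply: bigcupT_measurable => n; rewrite /F.
  case: (unpickle n) => [q|]; last exact: measurable0.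
  case: asboolP => _; last exact: measurable0.
  suff -> : f @^-1` box q = \bigcap_(i in [set: 'I_d])
      ((fun t => (f t : 'rV[R]_d) 0 i) @^-1` ball (ratr (q.1 0 i) : R) (ratr q.2)).
    apply: fin_bigcap_measurable => // i _.
    by rewrite -[X in measurable X]setTI; apply: mf => //; exact: measurable_ball.
  by apply/seteqP; split => t /= H i; [move=> _; exact: H | exact: H].
apply/seteqP; split => [t /= Ut|t [n _]]; last first.
  by rewrite /F; case: (unpickle n) => // q; case: asboolP => //= qU /qU.
have /nbhs_ballP[e /= e0 eU] : nbhs (f t : 'rV[R]_d) U.
  by move: oU; rewrite openE; exact.
have [r] : exists r : rat, ratr r \in `]e / 4, e / 2[%R.
  by apply: rat_in_itvoo; lra.
rewrite in_itv /= => /andP[er re].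
have /choice[q Hq] : forall i : 'I_d, exists q : rat,
    ball ((f t : 'rV[R]_d) 0 i) (e / 4) (ratr q).
  move=> i; have [q] : exists q : rat, ratr q \in
      `](f t : 'rV[R]_d) 0 i - e / 4, (f t : 'rV[R]_d) 0 i + e / 4[%R.
    by apply: rat_in_itvoo; lra.
  by rewrite ball_itv => qi; exists q.
exists (pickle (\row_i q i, r)) => //; rewrite /F pickleK.
case: asboolP => /= [_ i|[]].
  rewrite mxE; apply: ball_sym; apply: le_ball (Hq i); exact: ltW.
move=> v /= vb; apply: eU; split => // i j; rewrite ord1.
move: (Hq j) (vb j); rewrite mxE /= /ball /= => Hj vj.
have := ler_distD (ratr (q j) : R) ((f t : 'rV[R]_d) 0 j) (v 0 j); lra.
Qed.

(* Lebesgue measure on R^d, by recursion on d, as the image of the product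
   measure under R * R^d ~ R^(d+1). *)
Definition rV_cons (R : realType) (d : nat) (p : R * Rd R d) : Rd R d.+1 :=
  row_mx (const_mx p.1 : 'rV[R]_1) (p.2 : 'rV[R]_d).

Definition rV_uncons (R : realType) (d : nat) (v : Rd R d.+1) : R * Rd R d :=
  ((v : 'rV[R]_(1 + d)) 0 0, rsubmx (v : 'rV[R]_(1 + d))).

Lemma rV_consK (R : realType) (d : nat) :
  cancel (@rV_cons R d) (@rV_uncons R d).
Proof.
case=> x v; rewrite /rV_cons /rV_uncons /= row_mxKr; congr pair.
rewrite [X in row_mx _ _ _ X](_ : _ = lshift d (0 : 'I_1)); last exact: val_inj.
by rewrite row_mxEl mxE.
Qed.

Lemma rV_cons0 (R : realType) (d : nat) (p : R * Rd R d) :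
  (rV_cons p : 'rV[R]_d.+1) 0 ord0 = p.1.
Proof. by rewrite -[in RHS](rV_consK p). Qed.

Lemma rV_consS (R : realType) (d : nat) (p : R * Rd R d) (i : 'I_d) :
  (rV_cons p : 'rV[R]_d.+1) 0 (lift ord0 i) = (p.2 : 'rV[R]_d) 0 i.
Proof.
have -> : lift ord0 i = rshift 1 i by exact: val_inj.
exact: row_mxEr.
Qed.

Lemma measurable_rV_cons (R : realType) (d : nat) :
  measurable_fun [set: R * Rd R d] (@rV_cons R d).
Proof.
apply: measurable_rV => i; rewrite /rV_cons.
case: (@split_ordP 1 d i) => j ->.
  rewrite (_ : (fun _ => _) = fst); first exact: measurable_fst.
  by apply/funext => p; exact: (etrans (row_mxEl _ _ _ _) (mxE _ _ _ _)).
rewrite (_ : (fun _ => _) = (fun v : Rd R d => (v : 'rV[R]_d) 0 j) \o snd).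
  exact: (measurableT_comp (measurable_coord j) measurable_snd).
by apply/funext => p; exact: row_mxEr.
Qed.

Lemma measurable_rV_uncons (R : realType) (d : nat) :
  measurable_fun [set: Rd R d.+1] (@rV_uncons R d).
Proof.
apply: measurable_fun_pair; first exact: (@measurable_coord R d.+1 0).
apply: measurable_rV => i.
under eq_fun do rewrite mxE.
exact: (@measurable_coord R (1 + d)).
Qed.

Section lebesgue_step.
Context (R : realType) (d : nat) (mu : {sigma_finite_measure set (Rd R d) -> \bar R}).

Definition lebesgue_step : set (Rd R d.+1) -> \bar R :=
  pushforward (@lebesgue_measure R \x mu)%E (@rV_cons R d).

Let lebesgue_step0 : lebesgue_step set0 = 0%E.
Proof. by rewrite /lebesgue_step /pushforward preimage_set0 measure0. Qed.

Let lebesgue_step_ge0 A : (0 <= lebesgue_step A)%E.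
Proof. exact: (measure_ge0 (@lebesgue_measure R \x mu)%E). Qed.

Let lebesgue_step_sigma_additive : semi_sigma_additive lebesgue_step.
Proof.
have mc A : measurable A -> measurable (@rV_cons R d @^-1` A).
  by move=> mA; rewrite -[X in measurable X]setTI; exact: measurable_rV_cons.
move=> F mF tF mUF; rewrite /lebesgue_step /pushforward preimage_bigcup.
apply: measure_semi_sigma_additive.
- by move=> n; exact: mc.
- apply/trivIsetP => /= i j _ _ ij; rewrite -preimage_setI.
  by move/trivIsetP : tF => /(_ _ _ _ _ ij) ->//; rewrite preimage_set0.
- by rewrite -preimage_bigcup; exact: mc.
Qed.

HB.instance Definition _ := isMeasure.Build _ _ _ lebesgue_step
  lebesgue_step0 lebesgue_step_ge0 lebesgue_step_sigma_additive.

Let lebesgue_step_sigma_finite : sigma_finite setT lebesgue_step.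
Proof.
have [F FT mF] : sigma_finite setT (@lebesgue_measure R \x mu)%E.
  have /sigma_finiteP[G [TG ndG Goo]] := sigma_finiteT (@lebesgue_measure R).
  have /sigma_finiteP[H [TH ndH Hoo]] := sigma_finiteT mu.
  exists (fun n => G n `*` H n).
    rewrite -setXTT TG TH; apply/seteqP; split => -[x y] /=.
      move=> [[n _ Gnx] [k _ Hky]]; exists (maxn n k) => //; split.
        by move: x Gnx; exact/subsetPset/ndG/leq_maxl.
      by move: y Hky; exact/subsetPset/ndH/leq_maxr.
    by move=> [n _ [/= ? ?]]; split; exists n.
  move=> k; have [? ?] := Goo k; have [? ?] := Hoo k.
  split; first exact: measurableX.
  by rewrite product_measure1E// lte_mul_pinfty// ge0_fin_numE.
have FK n : @rV_cons R d @^-1` (@rV_uncons R d @^-1` F n) = F n.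
  by apply/seteqP; split => p /=; rewrite rV_consK.
exists (fun n => @rV_uncons R d @^-1` F n).
  by rewrite -preimage_bigcup -FT preimage_setT.
move=> n; have [mFn Fn] := mF n; split; last first.
  by rewrite /lebesgue_step /pushforward FK.
by rewrite -[X in measurable X]setTI; apply: measurable_rV_uncons.
Qed.

HB.instance Definition _ := Measure_isSigmaFinite.Build _ _ _ lebesgue_step
  lebesgue_step_sigma_finite.

End lebesgue_step.

Fixpoint lebesgue_Rd (R : realType) (d : nat) :
    {sigma_finite_measure set (Rd R d) -> \bar R} :=
  if d is n.+1 then lebesgue_step (lebesgue_Rd R n)
  else dirac ((0 : 'rV[R]_0) : Rd R 0).

Lemma lebesgue_Rd_prod (R : realType) (d : nat) (A : 'I_d -> set R) :
  (forall i, measurable (A i)) ->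
  lebesgue_Rd R d [set v | forall i, A i ((v : 'rV[R]_d) 0 i)] =
  (\prod_(i < d) lebesgue_measure (A i))%E.
Proof.
elim: d A => [|d IH] A mA.
  rewrite big_ord0 /= diracE mem_set//; by case.
rewrite big_ord_recl -IH; last by move=> i; exact: mA.
pose B : set (Rd R d) := [set v | forall i, A (lift ord0 i) ((v : 'rV[R]_d) 0 i)].
have mB : measurable B.
  have -> : B = \bigcap_(i in [set: 'I_d])
      ((fun v : Rd R d => (v : 'rV[R]_d) 0 i) @^-1` A (lift ord0 i)).
    by apply/seteqP; split => v /= H i; [move=> _; exact: H | exact: H].
  apply: fin_bigcap_measurable => // i _.
  by rewrite -[X in measurable X]setTI; apply: (measurable_coord i).
rewrite -/B -(product_measure1E (@lebesgue_measure R) (lebesgue_Rd R d) (mA ord0) mB).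
suff -> : A ord0 `*` B =
  @rV_cons R d @^-1` [set v | forall i, A i ((v : 'rV[R]_d.+1) 0 i)] by [].
apply/esym.
apply/seteqP; split => -[x v] /=.
  move=> H; split => [|i].
    by have := H ord0; rewrite rV_cons0.
  by have := H (lift ord0 i); rewrite rV_consS.
move=> [Ax Av] i; case: (unliftP ord0 i) => [j|] ->.
  by rewrite rV_consS; exact: Av.
by rewrite rV_cons0.
Qed.

Definition reflection (R : realType) (d : nat) (n : 'rV[R]_d) (c : R)
  (x : 'rV[R]_d) : 'rV[R]_d := x - (2 * (dot x n - c)) *: n.

(* Reflection across the affine hyperplane {x | <x, n> = c}, |n| = 1. *)
Definition is_reflection (R : realType) (d : nat)
    (g : 'rV[R]_d -> 'rV[R]_d) : Prop :=
  exists (n : 'rV[R]_d) (c : R), enorm n = 1 /\ g = reflection n c.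

Definition condW (R : realType) (d : nat) (W : 'rV[R]_d -> R) : Prop :=
  [/\ continuous W,
      forall x, 0 <= W x,
      exists2 C : R, 0 < C & forall x,
        C^-1 * enorm x ^+ 2 - C <= W x <= C * enorm x ^+ 2 + C &
      exists (ap am : 'rV[R]_d) (r : R),
        [/\ 0 < r, eball ap r `&` eball am r = set0 &
            forall x, W x = 0 <-> (eball ap r `|` eball am r) x]].

(* K is only meaningful on (0, +oo): its value at 0 is arbitrary, and is
   irrelevant both below and in the energy, where the diagonal is negligible. *)
Definition condK (R : realType) (d : nat) (K : R -> R) : Prop :=
  [/\ forall r, 0 < r -> 0 <= K r,
      forall A : set R, compact A -> A `<=` `[0, +oo[ ->
        (@lebesgue_measure R).-integrable A (fun r => (r ^+ d.-1 * K r)%:E),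
      {in `]0, +oo[ &, {homo K : r s / r <= s >-> s <= r}},
      forall t, 0 < t -> exists2 l : \bar R, (0 < l)%E &
        (K r - K (t + r))%:E @[r --> 0^'+] --> l &
      K r @[r --> +oo] --> 0].

(* f is a density of m with respect to Lebesgue measure.  Lebesgue-measurable
   functions are those equal a.e. to a Borel one, here g. *)
Definition has_density (R : realType) (d : nat)
    (m : set (Rd R d) -> \bar R) (f : Rd R d -> R) : Prop :=
  exists g : Rd R d -> R,
    [/\ measurable_fun [set: Rd R d] g,
        {ae lebesgue_Rd R d, forall x, f x = g x} &
        forall A, measurable A -> m A = \int[lebesgue_Rd R d]_(x in A) (g x)%:E]%E.

Definition P2 (R : realType) (d : nat) : set (probability (Rd R d) R) :=
  [set m : probability (Rd R d) R | (\int[m]_x (enorm x ^+ 2)%:E < +oo)%E].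

Definition P2r (R : realType) (d : nat) (rho : R) :
    set (probability (Rd R d) R) :=
  [set m : probability (Rd R d) R | P2 m /\ exists2 f, has_density m f &
    {ae lebesgue_Rd R d, forall x, 0 <= f x <= rho}].

Definition energy (R : realType) (d : nat) (W : 'rV[R]_d -> R) (K : R -> R)
    (m : probability (Rd R d) R) : \bar R :=
  (\int[m]_x (W x)%:E -
   \int[m]_y \int[m]_x (K (enorm ((x : 'rV[R]_d) - y)))%:E)%E.

Definition is_minimizer (R : realType) (d : nat) (rho : R)
    (W : 'rV[R]_d -> R) (K : R -> R) (m : probability (Rd R d) R) : Prop :=
  P2r rho m /\ forall m', P2r rho m' -> (energy W K m <= energy W K m')%E.

(* rho chi_E, as a density; it is a minimizer when it is the density of one
   (this forces E to be Lebesgue measurable). *)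
Definition patch_density (R : realType) (d : nat) (rho : R)
    (E : set (Rd R d)) : Rd R d -> R := fun x => rho * \1_E x.

Definition density_minimizer (R : realType) (d : nat) (rho : R)
    (W : 'rV[R]_d -> R) (K : R -> R) (f : Rd R d -> R) : Prop :=
  exists2 m, is_minimizer rho W K m & has_density m f.

(* Main.v *)
From HB Require Import structures.
Require Import Defs.
From mathcomp Require Import all_boot all_order all_algebra.
From mathcomp Require Import all_classical all_reals all_analysis measurable_realfun.
From mathcomp Require Import ring lra.

Set Implicit Arguments.
Unset Strict Implicit.
Unset Printing Implicit Defensive.

Import Order.TTheory GRing.Theory Num.Theory.
Import numFieldNormedType.Exports.

Local Open Scope classical_set_scope.
Local Open Scope ring_scope.

(** Let L be Lebesgue measure on R^d.  A probability m with finite second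
    moment is admissible exactly when m <= rho L as measures ([P2r_below],
    [below_P2r]), and admissible measures do not charge points, so K may be
    replaced by its extension by 0 outside (0,+oo), a nonnegative Borel
    function ([energyE]).

    Existence.  Since K is nonincreasing, comparison on dyadic shells turns the
    local integrability of r^(d-1) K(r) into that of K(|z|) near the origin
    ([radial_integrable_ball]).  Hence the interaction energy is bounded on
    measures below rho L, uniformly so after removal of a bounded truncation of
    the kernel ([interaction_truncation], [integral_tail_cvg0]).  Along a
    minimizing sequence the integrals of W are therefore bounded, and the
    coercivity of W makes the sequence tight ([bounded_W_tight]).  Define m(A) as
    the limit of m_n(A) along a free ultrafilter.  This is finitely additive for
    trivial reasons, and countably additive because the m_n are dominated by rho
    L up to a small mass ([ultralimit_probability]).  Setwise convergence passes
    to integrals of bounded functions ([cvg_integral_bounded]) and, since a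
    measure on a product is determined by rectangles, to the products m_n x m_n
    ([cvg_product]).  So truncated interactions converge while the integral of W
    is lower semicontinuous, and m is a minimizer ([exists_minimizer]).

    Bang-bang.  Suppose that the density g of a minimizer satisfies del <= g <=
    rho - del on a set of positive measure.  Choose two pieces A, B of that set
    whose diameters are very small compared with their distance t.  Moving a
    small mass from B to A, or from A to B, stays admissible.  The energy is
    quadratic along this line, and its second difference is minus twice (self
    energies of the two moved pieces - their mutual energies).  This is negative,
    because K near 0 is strictly larger than K(t) ([kernel_strict]); so one of
    the two moves decreases the energy ([minimizer_bang_bang]).  Hence g takes only the
    values 0 and rho almost everywhere ([minimizer_is_patch]).

    Symmetry.  A reflection g preserves distances and W, so pushing a minimizer
    forward by g gives a minimizer as soon as g preserves L.  Translation
    invariance and Tonelli give L(A) L(g^-1 B) = L(B) L(g^-1 A) for all Borel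
    A, B; taking for B a Euclidean ball centred at a fixed point of g yields
    L(g^-1 A) = L(A) ([lebesgue_Rd_reflection]). *)

(** * Measures given by a density *)

Section ProbabilityOfMeasure.
Context d (T : measurableType d) (R : realType).
Variables (mu : {measure set T -> \bar R}) (mu1 : mu setT = 1%E).

Let prob : set T -> \bar R := mu.
HB.instance Definition _ := Measure.on prob.
HB.instance Definition _ := Measure_isProbability.Build _ _ _ prob mu1.

Lemma exists_probability : exists P : probability T R, P = mu :> (set T -> \bar R).
Proof. by exists prob. Qed.

End ProbabilityOfMeasure.

Section Densities.
Context d (T : measurableType d) (R : realType).
Implicit Types (mu nu : {measure set T -> \bar R}) (g : T -> R).

Lemma exists_density_measure mu g :
  measurable_fun [set: T] g -> (forall x, 0 <= g x) ->
  exists nu : {measure set T -> \bar R},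
    forall A, measurable A -> nu A = (\int[mu]_(x in A) (g x)%:E)%E.
Proof.
move=> mg g0; pose dens A := (\int[mu]_(x in A) (g x)%:E)%E.
have dens0 : dens set0 = 0%E by rewrite /dens integral_set0.
have dens_ge0 A : (0 <= dens A)%E.
  by apply: integral_ge0 => x _; rewrite lee_fin.
have dens_sa : semi_sigma_additive dens.
  move=> F mF tF mUF; rewrite /dens ge0_integral_bigcup//=.
  - apply: is_cvg_ereal_nneg_natsum_cond => n _ _.
    by apply: integral_ge0 => x _; rewrite lee_fin.
  - by apply/measurable_EFinP; apply: measurable_funTS.
  - by move=> x _; rewrite lee_fin.
pose H := isMeasure.Build _ _ _ dens dens0 dens_ge0 dens_sa.
by exists (HB.pack_for {measure set T -> \bar R} dens H).
Qed.

Import HBNNSimple.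

(** True for indicators by hypothesis, hence for simple functions by linearity,
    hence in general by monotone convergence. *)
Lemma integral_density mu nu g :
  measurable_fun [set: T] g -> (forall x, 0 <= g x) ->
  (forall A, measurable A -> nu A = (\int[mu]_(x in A) (g x)%:E)%E) ->
  forall f : T -> \bar R, measurable_fun [set: T] f -> (forall x, (0 <= f x)%E) ->
  (\int[nu]_x f x = \int[mu]_x (f x * (g x)%:E))%E.
Proof.
move=> mg g0 nuE f mf f0.
pose f_ := nnsfun_approx measurableT mf.
have nd t : {homo (fun n => (f_ n t)%:E) : m n / (m <= n)%N >-> (m <= n)%E}.
  by move=> m n mn; rewrite lee_fin; exact/lefP/nd_nnsfun_approx.
have mfn n : measurable_fun setT (fun t => (f_ n t)%:E).
  exact/measurable_EFinP.
have mgE : measurable_fun setT (fun t => (g t)%:E) by exact/measurable_EFinP.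
have fcvg x : (f_ n x)%:E @[n --> \oo] --> f x.
  by apply: cvg_nnsfun_approx.
transitivity (limn (fun n => \int[nu]_x (f_ n x)%:E)%E).
  rewrite -monotone_convergence//=.
    by apply: eq_integral => x _; apply/esym/cvg_lim => //; exact: fcvg.
  by move=> n x _; rewrite lee_fin.
transitivity (limn (fun n => \int[mu]_x ((f_ n x)%:E * (g x)%:E))%E); last first.
  rewrite -monotone_convergence//=.
  - apply: eq_integral => x _; apply/cvg_lim => //.
    by apply: cvgeZr => //; exact: fcvg.
  - by move=> n; exact: emeasurable_funM.
  - by move=> n x _; rewrite mule_ge0// lee_fin.
  - by move=> x _ m n mn; rewrite lee_wpmul2r// ?lee_fin//; have := nd x _ _ mn; rewrite lee_fin.
congr (limn _); apply/funext => n; move: (f_ n) => {nd mfn fcvg f_}h.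
have mi k : measurable (h @^-1` [set k]) by exact: measurable_sfunP.
rewrite integralT_nnsfun sintegralE.
transitivity (\sum_(k \in range h)
    \int[mu]_x (k%:E * ((\1_(h @^-1` [set k]) x)%:E * (g x)%:E)))%E.
  apply: eq_fsbigr => k; rewrite inE => -[z _ <-].
  rewrite ge0_integralZl ?lee_fin//=; last 2 first.
    by apply: emeasurable_funM => //; exact/measurable_EFinP.
    by move=> x _; rewrite mule_ge0 ?lee_fin.
  congr (_ * _)%E.
  rewrite nuE// integral_mkcond; apply: eq_integral => x _.
  rewrite patchE indicE; case: ifPn => _; first by rewrite mul1e.
  by rewrite mul0e.
rewrite -ge0_integral_fsum//.
- apply: eq_integral => x _.
  rewrite (fimfunE h x) -fsumEFin//.
  rewrite ge0_mule_fsuml; last first.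
    move=> r; have := nnfun_muleindic_ge0 h r x; rewrite EFinM; exact.
  by apply: eq_fsbigr => i _; rewrite EFinM muleA.
- move=> r; apply: emeasurable_funM => //; apply: emeasurable_funM => //.
  exact/measurable_EFinP.
- move=> r x _; rewrite muleA mule_ge0// ?lee_fin//.
  by have := nnfun_muleindic_ge0 h r x.
Qed.

End Densities.

(** * Limits of probability measures along an ultrafilter *)

Lemma prob_integral_bounded d (T : measurableType d) (R : realType)
    (Q : probability T R) (h : T -> R) (N : R) :
  measurable_fun [set: T] h -> (forall x, 0 <= h x <= N) ->
  (\int[Q]_x (h x)%:E)%E \is a fin_num /\ 0 <= fine (\int[Q]_x (h x)%:E) <= N.
Proof.
move=> mh hN.
have le : (0 <= \int[Q]_x (h x)%:E <= N%:E)%E.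
  apply/andP; split.
    by apply: integral_ge0 => x _; rewrite lee_fin; have /andP[] := hN x.
  rewrite (_ : N%:E = \int[Q]_x (cst N%:E x))%E; last first.
    by rewrite integral_cst//= probability_setT mule1.
  apply: ge0_le_integral => //.
  - by move=> x _; rewrite lee_fin; have /andP[] := hN x.
  - exact/measurable_EFinP.
  - by move=> x _; rewrite lee_fin; have /andP[] := hN x.
have fi : (\int[Q]_x (h x)%:E)%E \is a fin_num.
  by move/andP: le => [l0 l1]; rewrite ge0_fin_numE// (le_lt_trans l1)// ltry.
by split => //; rewrite -!lee_fin fineK.
Qed.

Section UltraLimits.
Context (R : realType) (U : set_system nat) {FU : UltraFilter U}.

(** A cluster point, which exists by compactness, is a limit along an
    ultrafilter. *)
Lemma ultra_cvg_bounded (u : nat -> R) (a b : R) :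
  (forall n, a <= u n <= b) -> exists l : R, u @ U --> l.
Proof.
move=> uab.
have UT : (u @ U) `[a, b]%classic.
  have UT : U setT by exact: filterT.
  by apply: (@filterS _ U _ _ _ _ UT) => n _ /=; rewrite in_itv; exact: uab.
have [l [_ cl]] := @segment_compact R a b (u @ U) _ UT.
exists l => B nB /=.
have [//|UnB] := in_ultra_setVsetC (u @^-1` B) FU.
have /set0P/negP : (~` B) `&` B !=set0.
  by apply: cl => //; rewrite /fmap /=.
by rewrite setICl eqxx.
Qed.

Context d (T : measurableType d).

(** A uniform absolute continuity: it prevents mass from escaping along a
    decreasing sequence of sets with empty intersection, which is what a setwise
    limit needs in order to be countably additive. *)
Definition nearly_dominated (nu : nat -> probability T R) :=
  forall e : R, 0 < e -> exists2 tau : {measure set T -> \bar R},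
    (tau setT < +oo)%E &
    forall n A, measurable A -> (nu n A <= tau A + e%:E)%E.

(** Finite additivity passes to the limit.  For countable additivity, the tails
    of a disjoint union have small tau-measure, hence small limit measure. *)
Lemma ultralimit_probability (nu : nat -> probability T R) :
  nearly_dominated nu ->
  exists P : probability T R, forall A, measurable A ->
    fine (nu n A) @[n --> U] --> fine (P A).
Proof.
move=> dom.
have fnu n A : measurable A -> nu n A \is a fin_num.
  by move=> mA; exact: fin_num_measure.
have nu01 A : measurable A -> forall n, 0 <= fine (nu n A) <= 1.
  move=> mA n; rewrite fine_ge0//= -lee_fin fineK ?fnu//.
  exact: probability_le1.
pose L A : R := lim (fine (nu n A) @[n --> U]).
have LP A : measurable A -> fine (nu n A) @[n --> U] --> L A.
  move=> mA; have [l ul] := ultra_cvg_bounded (nu01 A mA).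
  by apply/cvg_ex; exists l.
have L_eq A l : fine (nu n A) @[n --> U] --> l -> L A = l.
  by move=> h; exact/cvg_lim.
have L0 A : measurable A -> 0 <= L A.
  move=> mA; apply: limr_ge; first by apply/cvg_ex; exists (L A); exact: LP.
  by apply: nearW => n; have /andP[] := nu01 _ mA n.
have LD A B : measurable A -> measurable B -> A `&` B = set0 ->
    L (A `|` B) = L A + L B.
  move=> mA mB AB; apply: L_eq.
  have -> : (fun n => fine (nu n (A `|` B))) =
      (fun n => fine (nu n A) + fine (nu n B)).
    by apply/funext => n; rewrite measureU// fineD// fnu.
  by apply: cvgD; exact: LP.
have Lset0 : L set0 = 0.
  apply: L_eq; under eq_fun do rewrite measure0; exact: cvg_cst.
have LT : L setT = 1.
  apply: L_eq; under eq_fun do rewrite probability_setT; exact: cvg_cst.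
have Ldom e (tau : {measure set T -> \bar R}) : (tau setT < +oo)%E ->
    (forall n A, measurable A -> (nu n A <= tau A + e%:E)%E) ->
    forall A, measurable A -> L A <= fine (tau A) + e.
  move=> tauT ht A mA.
  have tauA : tau A \is a fin_num.
    rewrite ge0_fin_numE// (le_lt_trans _ tauT)//.
    by apply: le_measure; rewrite ?inE.
  apply: limr_le; first by apply/cvg_ex; exists (L A); exact: LP.
  apply: nearW => n; rewrite -lee_fin fineK ?fnu// EFinD fineK//.
  exact: ht.
pose mu A : \bar R := if `[< measurable A >] then (L A)%:E else 0%E.
have muE A : measurable A -> mu A = (L A)%:E.
  by move=> mA; rewrite /mu; case: asboolP.
have mu0 : mu set0 = 0%E by rewrite muE// Lset0.
have mu_ge0 A : (0 <= mu A)%E.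
  by rewrite /mu; case: asboolP => // mA; rewrite lee_fin L0.
have mu_sa : semi_sigma_additive mu.
  move=> F mF tF mUF.
  pose S n := \big[setU/set0]_(i < n) F i.
  have mS n : measurable (S n) by exact: bigsetU_measurable.
  have SUF n : S n `<=` \bigcup_i F i.
    by rewrite /S -bigcup_mkord => x [i _ Fx]; exists i.
  have LS n : L (S n) = \sum_(0 <= i < n) L (F i).
    elim: n => [|n IH]; first by rewrite /S big_ord0 big_nil.
    rewrite big_nat_recr//= -IH /S big_ord_recr/= LD//.
      exact: mS.
    rewrite -bigcup_mkord setI_bigcupl; apply: bigcup0 => i /= ni.
    by move/trivIsetP: tF; apply => //; rewrite lt_eqF.
  have -> : (fun n => \sum_(0 <= i < n) mu (F i))%E = (fun n => (L (S n))%:E).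
    apply/funext => n; rewrite LS -sumEFin; apply: eq_bigr => i _; exact: muE.
  rewrite muE//; apply/cvg_EFin; first by exact: nearW.
  pose D n := (\bigcup_i F i) `\` S n.
  have mD n : measurable (D n) by exact: measurableD.
  have LSD n : L (S n) = L (\bigcup_i F i) - L (D n).
    apply/eqP; rewrite -subr_eq opprK eq_sym; apply/eqP.
    rewrite -LD//; last by rewrite /D setDIK.
    by congr L; rewrite /D setDUK.
  rewrite [X in X @ _ --> _](_ : _ = (fun n => L (\bigcup_i F i) - L (D n)));
    last by apply/funext => n /=; rewrite LSD.
  rewrite -[X in _ --> X]subr0; apply: cvgB; first exact: cvg_cst.
  apply/cvgrPdist_le => e e0.
  have e20 : 0 < e / 2 by rewrite divr_gt0.
  have [tau tauT ht] := dom _ e20.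
  have tauD : tau (D n) @[n --> \oo] --> 0%E.
    have -> : 0%E = tau (\bigcap_n D n).
      rewrite [X in tau X](_ : _ = set0) ?measure0//.
      apply/seteqP; split => // x Dx; have [[i _ Fix] _] := Dx 0%N I.
      have [_ []] := Dx i.+1 I.
      by rewrite /S big_ord_recr/=; right.
    apply: nonincreasing_cvg_mu => //.
    - rewrite (le_lt_trans _ tauT)//; apply: le_measure; rewrite ?inE//.
    - exact: bigcapT_measurable.
    - move=> m n mn; apply/subsetPset; apply: setDS.
      by rewrite /S; apply: subset_bigsetU.
  have tauDfin n : tau (D n) \is a fin_num.
    rewrite ge0_fin_numE// (le_lt_trans _ tauT)//.
    by apply: le_measure; rewrite ?inE.
  have /fine_cvgP[_ /cvgrPdist_le /(_ _ e20)] := tauD.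
  apply: filterS => n /=; rewrite !sub0r !normrN.
  rewrite ger0_norm ?fine_ge0// ger0_norm ?L0// => h.
  have := Ldom _ _ tauT ht (D n) (mD n); move: h; lra.
pose H := isMeasure.Build _ _ _ mu mu0 mu_ge0 mu_sa.
pose M := HB.pack_for {measure set T -> \bar R} mu H.
have MT : M setT = 1%E by rewrite /M/= muE// LT.
have [P PM] := exists_probability MT.
exists P => A mA; rewrite PM /=.
by rewrite muE//; exact: LP.
Qed.

(** For 0 <= h <= N, subtracting (N/2) 1_{h >= N/2} leaves a function with values
    in [0, N/2], and the integrals of the subtracted part converge by hypothesis.
    Iterating k times bounds the error by N / 2^k up to e. *)
Lemma cvg_integral_bounded (nu : nat -> probability T R) (P : probability T R) :
  (forall A, measurable A -> fine (nu n A) @[n --> U] --> fine (P A)) ->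
  forall (f : T -> R) (M : R), measurable_fun [set: T] f ->
  (forall x, 0 <= f x <= M) ->
  fine (\int[nu n]_x (f x)%:E) @[n --> U] --> fine (\int[P]_x (f x)%:E).
Proof.
move=> nuP f M mf fM.
have key k : forall (h : T -> R) (N e : R), measurable_fun setT h -> 0 < e ->
    (forall x, 0 <= h x <= N) ->
    \forall n \near U, `|fine (\int[P]_x (h x)%:E) - fine (\int[nu n]_x (h x)%:E)|
      <= N / 2 ^+ k + e.
  elim: k => [|k IH] h N e mh e0 hN.
    apply: nearW => n; rewrite expr0 divr1 ler_norml.
    have [_ /andP[? ?]] := prob_integral_bounded P mh hN.
    have [_ /andP[? ?]] := prob_integral_bounded (nu n) mh hN.
    by apply/andP; split; lra.
  pose A := [set x | N / 2 <= h x].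
  have mA : measurable A.
    rewrite (_ : A = h @^-1` `[N / 2, +oo[%classic); last first.
      by apply/seteqP; split => x /=; rewrite in_itv/= andbT.
    by rewrite -[X in measurable X]setTI; exact: mh.
  have [x0|NT] := pselect (exists x : T, True); last first.
    apply: nearW => n.
    have fe (Q : probability T R) : (\int[Q]_x (h x)%:E = 0)%E.
      by apply: integral0_eq => x _; exfalso; apply: NT; exists x.
    have := @probability_setT _ _ _ P.
    rewrite (_ : setT = set0) ?measure0.
      by move=> /eqP; rewrite eq_sym onee_eq0.
    by apply/seteqP; split => x _ //; exfalso; apply: NT; exists x.
  have N0 : 0 <= N by case: x0 => x _; have /andP[a b] := hN x; exact: le_trans b.
  pose h' x := h x - N / 2 * \1_A x.
  have mh' : measurable_fun setT h'.
    apply: measurable_funB => //; apply: measurable_funM => //.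
  have hN' x : 0 <= h' x <= N / 2.
    rewrite /h' indicE; have /andP[? ?] := hN x.
    case: (boolP (x \in A)); rewrite ?inE ?notin_setE /A /=.
      by move=> ?; apply/andP; split; lra.
    by move=> /negP; rewrite -ltNge => ?; apply/andP; split; lra.
  have split (Q : probability T R) : fine (\int[Q]_x (h x)%:E) =
      fine (\int[Q]_x (h' x)%:E) + N / 2 * fine (Q A).
    have -> : (\int[Q]_x (h x)%:E)%E =
        (\int[Q]_x (h' x)%:E + \int[Q]_x ((N / 2)%:E * (\1_A x)%:E))%E.
      rewrite -ge0_integralD//.
      - by apply: eq_integral => x _; rewrite -EFinM -EFinD /h' subrK.
      - by move=> x _; rewrite lee_fin; have /andP[] := hN' x.
      - exact/measurable_EFinP.
      - by move=> x _; rewrite mule_ge0// lee_fin// divr_ge0.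
      - apply: emeasurable_funM => //; exact/measurable_EFinP.
    rewrite ge0_integralZl//; last 2 first.
      by apply/measurable_EFinP.
      by rewrite lee_fin divr_ge0.
    rewrite integral_indic// setIT.
    have fQ : Q A \is a fin_num by exact: fin_num_measure.
    rewrite fineD ?fineM//; first by have [] := prob_integral_bounded Q mh' hN'.
    by rewrite fin_numM.
  have e2 : 0 < e / 2 by rewrite divr_gt0.
  have e3 : 0 < e / 2 / (N + 1) by rewrite divr_gt0// ltr_pwDr.
  have H1 := IH h' (N / 2) (e / 2) mh' e2 hN'.
  have /cvgrPdist_le /(_ _ e3) H2 := nuP A mA.
  apply: filterS2 H1 H2 => n H1 H2.
  rewrite !split.
  have -> : N / 2 ^+ k.+1 = N / 2 / 2 ^+ k by rewrite exprS invfM mulrA.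
  have H3 : `|N / 2 * (fine (P A) - fine (nu n A))| <= e / 2.
    rewrite normrM ger0_norm ?divr_ge0//.
    apply: (@le_trans _ _ ((N + 1) * (e / 2 / (N + 1)))).
      by apply: ler_pM => //; lra.
    by rewrite mulrC divfK// gt_eqF// ltr_pwDr.
  move: H1 H3; rewrite !ler_norml => /andP[? ?] /andP[? ?].
  by apply/andP; split; lra.
apply/cvgrPdist_le => e e0.
have e2 : 0 < e / 2 by rewrite divr_gt0.
have [k hk] : exists k, M / 2 ^+ k <= e / 2.
  have : (fun k => M / 2 ^+ k) @ \oo --> (0 : R).
    rewrite -[X in _ --> X](mulr0 M).
    apply: cvgM; first exact: cvg_cst.
    under eq_fun do rewrite -exprVn.
    by apply: cvg_expr; rewrite ger0_norm ?invf_lt1// ltr1n.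
  move=> /cvgrPdist_le /(_ _ e2) [k _ /(_ k (leqnn k))] /= h.
  by exists k; rewrite (le_trans _ h)// sub0r normrN ler_norm.
have := key k f M _ mf e2 fM; apply: filterS => n /= h.
by rewrite (le_trans h)//; lra.
Qed.

End UltraLimits.

Section ProductLimits.
Context (R : realType) d (T : measurableType d).

(** Outside B x B the mass is at most e + e; inside, integrate the domination of
    the sections of C against the restriction of Q to B, itself below tau. *)
Lemma product_dominated (Q : probability T R) (B : set T)
    (tau : {finite_measure set T -> \bar R}) (e : R) :
  measurable B -> (Q (~` B) <= e%:E)%E ->
  (forall A, measurable A -> (Q (A `&` B) <= tau A)%E) ->
  forall C : set (T * T), measurable C ->
  ((Q \x Q) C <= (tau \x tau) C + (e + e)%:E)%E.
Proof.
move=> mB QB Qtau C mC.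
have mBB : measurable (B `*` B) by exact: measurableX.
have step : ((Q \x Q) (C `&` (B `*` B)) <= (tau \x tau) C)%E.
  have mi : measurable_fun [set: T] (\1_B : T -> R) by exact: measurable_indic.
  have i0 x : 0 <= (\1_B x : R) by [].
  have QBE A : measurable A ->
      mrestr Q mB A = (\int[Q]_(x in A) (\1_B x)%:E)%E.
    by move=> mA; rewrite integral_indic// /mrestr setIC.
  rewrite /product_measure1.
  apply: (@le_trans _ _ (\int[mrestr Q mB]_x (tau \o xsection C) x)%E); last first.
    apply: ge0_le_measure_integral => //.
    exact: measurable_fun_xsection.
  rewrite (integral_density mi i0 QBE)//; last exact: measurable_fun_xsection.
  apply: ge0_le_integral => //.
  - by apply: measurable_fun_xsection; exact: measurableI.
  - apply: emeasurable_funM; first exact: measurable_fun_xsection.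
    exact/measurable_EFinP.
  move=> x _ /=; rewrite indicE; case: (boolP (x \in B)) => xB.
    rewrite mule1 xsectionI in_xsectionX//; apply: Qtau.
    exact: measurable_xsection.
  by rewrite mule0 xsectionI notin_xsectionX// setI0 measure0.
have QT1 : (Q \x Q)%E (~` B `*` setT) = Q (~` B).
  rewrite product_measure1E//; last exact: measurableC.
  by rewrite /= probability_setT mule1.
have QT2 : (Q \x Q)%E (setT `*` ~` B) = Q (~` B).
  rewrite product_measure1E//; last exact: measurableC.
  by rewrite /= probability_setT mul1e.
have mB1 : measurable (~` B `*` [set: T]).
  by apply: measurableX => //; exact: measurableC.
have mB2 : measurable ([set: T] `*` ~` B).
  by apply: measurableX => //; exact: measurableC.
have sub : C `<=` (C `&` (B `*` B)) `|` (~` B `*` setT `|` setT `*` ~` B).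
  move=> [x y] Cxy; have [Bx|nBx] := pselect (B x); last by right; left.
  by have [By|nBy] := pselect (B y); [left|right; right].
have mCB : measurable (C `&` (B `*` B)) by exact: measurableI.
apply: (@le_trans _ _ ((Q \x Q)%E ((C `&` (B `*` B)) `|` (~` B `*` setT `|` setT `*` ~` B)))).
  apply: le_measure; rewrite ?inE//; apply: measurableU => //; exact: measurableU.
apply: (le_trans (measureU2 _ _ _)) => //; first exact: measurableU.
apply: leeD => //; rewrite EFinD.
apply: (le_trans (measureU2 _ _ _)) => //.
by rewrite /= QT1 QT2 leeD.
Qed.

(** Stronger than [nearly_dominated] in that the exceptional mass sits outside one
    fixed set; this form is inherited by products. *)
Definition uniformly_tight (nu : nat -> probability T R) :=
  forall e : R, 0 < e ->
  exists B : set T, exists tau : {finite_measure set T -> \bar R},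
    [/\ measurable B, forall n, (nu n (~` B) <= e%:E)%E &
        forall n A, measurable A -> (nu n (A `&` B) <= tau A)%E].

Lemma tight_nearly_dominated nu : uniformly_tight nu -> nearly_dominated nu.
Proof.
move=> ut e e0; have [B [tau [mB nuB nutau]]] := ut _ e0.
have tauT : (tau setT < +oo)%E.
  by rewrite -ge0_fin_numE//; exact: (fin_num_measure tau).
exists tau; first exact: tauT.
move=> n A mA.
have mAB : measurable (A `&` B) by exact: measurableI.
have mnB : measurable (~` B) by exact: measurableC.
apply: (@le_trans _ _ (nu n ((A `&` B) `|` ~` B))).
  apply: le_measure; rewrite ?inE//; first exact: measurableU.
  by move=> x Ax; have [Bx|nBx] := pselect (B x); [left|right].
apply: (le_trans (measureU2 _ _ _)) => //.
by apply: leeD; [exact: nutau|exact: nuB].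
Qed.

Lemma tight_product_nearly_dominated (nu : nat -> probability T R) :
  uniformly_tight nu -> 
  @nearly_dominated R _ (T * T)%type (fun n => (nu n \x nu n)%E).
Proof.
move=> ut e e0.
have e20 : 0 < e / 2 by rewrite divr_gt0.
have [B [tau [mB nuB nutau]]] := ut _ e20.
exists (tau \x tau)%E.
  rewrite -setXTT /= product_measure1E// ltey_eq fin_numM//;
    exact: (fin_num_measure tau).
move=> n C mC; have := product_dominated mB (nuB n) (nutau n) mC.
by rewrite -splitr.
Qed.

(** The products have a setwise limit of their own; it has the right values on
    rectangles, so it is the product of the limits. *)
Lemma cvg_product (U : set_system nat) {FU : UltraFilter U}
    (nu : nat -> probability T R) (P : probability T R) :
  uniformly_tight nu ->
  (forall A, measurable A -> fine (nu n A) @[n --> U] --> fine (P A)) ->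
  forall C : set (T * T), measurable C ->
  fine ((nu n \x nu n)%E C) @[n --> U] --> fine ((P \x P)%E C).
Proof.
move=> ut nuP.
have [Q QP] := @ultralimit_probability R U _ _ _ _ (tight_product_nearly_dominated ut).
suff PQ C : measurable C -> (P \x P)%E C = Q C.
  by move=> C mC; rewrite PQ//; exact: QP.
apply: product_measure_unique => A B mA mB.
have fP D : measurable D -> P D \is a fin_num by move=> ?; exact: fin_num_measure.
have mAB : measurable (A `*` B) by exact: measurableX.
rewrite -[LHS]fineK; last exact: (fin_num_measure Q _ mAB).
rewrite /= -(fineK (fP _ mA)) -(fineK (fP _ mB)) -EFinM; congr EFin.
have /cvg_lim <- // := QP _ mAB.
apply/cvg_lim => //.
have -> : (fun n => fine ((nu n \x nu n)%E (A `*` B))) =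
    (fun n => fine (nu n A) * fine (nu n B)).
  apply/funext => n; rewrite -fineM; [|exact: (fin_num_measure (nu n))..].
  by rewrite /= product_measure1E.
by apply: cvgM; exact: nuP.
Qed.

End ProductLimits.

(** * Lebesgue measure on R^d and its invariance under reflections *)

Lemma integral_image d1 d2 (X : measurableType d1) (Y : measurableType d2)
    (R : realType) (mu : {measure set X -> \bar R})
    (nu : {measure set Y -> \bar R}) (phi : X -> Y) :
  measurable_fun [set: X] phi ->
  (forall A, measurable A -> nu A = mu (phi @^-1` A)) ->
  forall f : Y -> \bar R, measurable_fun [set: Y] f -> (forall y, (0 <= f y)%E) ->
  (\int[nu]_y f y = \int[mu]_x f (phi x))%E.
Proof.
move=> mphi nuE f mf f0.
transitivity (\int[pushforward mu phi]_y f y)%E; last first.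
  by rewrite ge0_integral_pushforward// preimage_setT.
have HB_phi := isMeasurableFun.Build _ _ _ _ phi mphi.
pose g : {mfun X >-> Y} := HB.pack phi HB_phi.
rewrite -[in RHS]/(pushforward mu g).
by apply: eq_measure_integral => A mA _; exact: nuE.
Qed.

Lemma lebesgue_measure_opp (R : realType) (t : R) (A : set R) : measurable A ->
  lebesgue_measure ((fun x : R => t - x) @^-1` A) = lebesgue_measure A.
Proof.
move=> mA.
have mf : measurable_fun [set: R] (fun x : R => t - x) by exact: measurable_funB.
have HB_f := isMeasurableFun.Build _ _ (measurableTypeR R) (measurableTypeR R)
  (fun x : R => t - x) mf.
pose f : {mfun measurableTypeR R >-> measurableTypeR R} := HB.pack (fun x : R => t - x) HB_f.
apply/esym; rewrite -[RHS]/(pushforward lebesgue_measure f A).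
apply: lebesgue_measure_unique => //= _ [[a b]] _ <-.
rewrite /pushforward.
have -> : (fun x : R => t - x) @^-1` [set` `]a, b]] = [set` `[t - b, t - a[%R].
  apply/seteqP; split => x /=; rewrite !in_itv/= => /andP[? ?]; apply/andP; split; lra.
rewrite !lebesgue_measure_itv/= !lte_fin.
have -> : (t - b < t - a) = (a < b) by apply/idP/idP; lra.
by case: ifPn => // _; congr EFin; lra.
Qed.
Section EuclideanSpace.
Context (R : realType).

Lemma dotD d (x y z : 'rV[R]_d) : dot (x + y) z = dot x z + dot y z.
Proof.
by rewrite /dot -big_split; apply: eq_bigr => i _; rewrite mxE mulrDl.
Qed.

Lemma dotZ d (a : R) (x z : 'rV[R]_d) : dot (a *: x) z = a * dot x z.
Proof.
by rewrite /dot big_distrr; apply: eq_bigr => i _; rewrite mxE /= mulrA.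
Qed.

Lemma dotN d (x z : 'rV[R]_d) : dot (- x) z = - dot x z.
Proof. by rewrite -scaleN1r dotZ mulN1r. Qed.

Lemma dotC d (x y : 'rV[R]_d) : dot x y = dot y x.
Proof. by apply: eq_bigr => i _; rewrite mulrC. Qed.

Lemma dot_ge0 d (x : 'rV[R]_d) : 0 <= dot x x.
Proof. by apply: sumr_ge0 => i _; rewrite -expr2 sqr_ge0. Qed.

Lemma enorm_sqr d (x : 'rV[R]_d) : enorm x ^+ 2 = dot x x.
Proof. by rewrite sqr_sqrtr// dot_ge0. Qed.

Lemma enorm_ge0 d (x : 'rV[R]_d) : 0 <= enorm x.
Proof. exact: sqrtr_ge0. Qed.

Lemma coord_le_enorm d (x : 'rV[R]_d) i : `|x 0 i| <= enorm x.
Proof.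
rewrite -sqrtr_sqr; apply: ler_wsqrtr; rewrite /dot (bigD1 i)//= -expr2.
by rewrite lerDl sumr_ge0// => j _; rewrite -expr2 sqr_ge0.
Qed.

Lemma enorm_eq0 d (x : 'rV[R]_d) : enorm x = 0 -> x = 0.
Proof.
move=> x0; apply/rowP => i; rewrite mxE; apply/eqP.
by rewrite -normr_le0 -x0 coord_le_enorm.
Qed.

Lemma enorm0 d : enorm (0 : 'rV[R]_d) = 0.
Proof. by rewrite /enorm /dot big1 ?sqrtr0// => i _; rewrite mxE mul0r. Qed.

Lemma enormN d (x : 'rV[R]_d) : enorm (- x) = enorm x.
Proof. by rewrite /enorm /dot; congr Num.sqrt; apply: eq_bigr => i _; rewrite mxE mulrNN. Qed.

(** The factor d is not sharp (sqrt d would be); it is only meant to fit cubes into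
    balls. *)
Lemma enorm_le_coord d (x : 'rV[R]_d) (c : R) : 0 <= c ->
  (forall i, `|x 0 i| <= c) -> enorm x <= d%:R * c.
Proof.
move=> c0 xc.
rewrite -(@ler_pXn2r _ 2)//; last 2 first.
  by rewrite nnegrE enorm_ge0.
  by rewrite nnegrE mulr_ge0.
rewrite enorm_sqr.
apply: (@le_trans _ _ (\sum_(i < d) c ^+ 2)).
  apply: ler_sum => i _; rewrite -expr2 -real_normK ?num_real//.
  by rewrite ler_pXn2r ?nnegrE.
rewrite sumr_const card_ord -[leLHS]mulr_natl exprMn.
apply: ler_wpM2r; first exact: sqr_ge0.
by rewrite -natrX ler_nat; case: (d) => // n; rewrite expnS expn1 leq_pmulr.
Qed.

Lemma measurable_continuous d (f : 'rV[R]_d -> R) :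
  continuous f -> measurable_fun [set: Rd R d] f.
Proof.
move=> cf; apply: (measurability _ (RGenOpens.measurableE R)).
move=> _ [_ [a [b ->] <-]]; rewrite setTI; apply: sub_sigma_algebra.
by move/continuousP : cf; apply; exact: interval_open.
Qed.

Lemma measurable_sub d :
  measurable_fun [set: Rd R d * Rd R d]
    (fun p => (p.1 : 'rV[R]_d) - (p.2 : 'rV[R]_d) : Rd R d).
Proof.
apply: measurable_rV => i.
under eq_fun do rewrite 2!mxE.
apply: measurable_funB.
  exact: (measurableT_comp (measurable_coord i) measurable_fst).
exact: (measurableT_comp (measurable_coord i) measurable_snd).
Qed.

Lemma measurable_subl d (t : 'rV[R]_d) :
  measurable_fun [set: Rd R d] (fun x : Rd R d => t - (x : 'rV[R]_d) : Rd R d).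
Proof.
apply: measurable_rV => i.
under eq_fun do rewrite 2!mxE.
by apply: measurable_funB => //; exact: (measurable_coord i).
Qed.

Lemma measurable_addr d (t : 'rV[R]_d) :
  measurable_fun [set: Rd R d] (fun x : Rd R d => (x : 'rV[R]_d) + t : Rd R d).
Proof.
apply: measurable_rV => i.
under eq_fun do rewrite mxE.
by apply: measurable_funD => //; exact: (measurable_coord i).
Qed.

Lemma measurable_dot d (n : 'rV[R]_d) :
  measurable_fun [set: Rd R d] (fun x : Rd R d => dot (x : 'rV[R]_d) n).
Proof.
apply: measurable_sum => i; apply: measurable_funM => //.
exact: (measurable_coord i).
Qed.

Lemma measurable_enorm d : measurable_fun [set: Rd R d] (@enorm R d).
Proof.
apply: (@measurableT_comp _ _ _ _ _ _ (@Num.sqrt R)).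
  exact: (continuous_measurable_fun (@sqrt_continuous R)).
apply: measurable_sum => i; apply: measurable_funM; exact: (measurable_coord i).
Qed.

(** Induction on d: on the product R x R^d the map x |-> t - x acts on each factor. *)
Lemma lebesgue_Rd_opp d (t : 'rV[R]_d) (A : set (Rd R d)) : measurable A ->
  lebesgue_Rd R d ((fun x : Rd R d => t - (x : 'rV[R]_d) : Rd R d) @^-1` A) =
  lebesgue_Rd R d A.
Proof.
elim: d t A => [|d IH] t A mA.
  congr (lebesgue_Rd R 0 _); apply/seteqP.
  by split => x /=; rewrite [t - _]thinmx0 (thinmx0 x).
have mC (B : set (Rd R d.+1)) : measurable B -> measurable (@rV_cons R d @^-1` B).
  by move=> mB; rewrite -[X in measurable X]setTI; exact: measurable_rV_cons.
pose t0 : R := t 0 0; pose t' : 'rV[R]_d := \row_i t 0 (lift ord0 i).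
have consB (p : R * Rd R d) : t - (rV_cons p : 'rV[R]_d.+1) =
    (rV_cons (t0 - p.1, t' - (p.2 : 'rV[R]_d) : Rd R d) : 'rV[R]_d.+1).
  apply/rowP => i; rewrite 2!mxE; case: (unliftP ord0 i) => [j|] ->.
    by rewrite !rV_consS /= !mxE.
  by rewrite !rV_cons0.
change ((lebesgue_measure \x lebesgue_Rd R d)%E
    (@rV_cons R d @^-1` ((fun x : Rd R d.+1 => t - (x : 'rV[R]_d.+1) : Rd R d.+1) @^-1` A)) =
  (lebesgue_measure \x lebesgue_Rd R d)%E (@rV_cons R d @^-1` A)).
rewrite /product_measure1.
set B := @rV_cons R d @^-1` A.
have mB : measurable B by exact: mC.
transitivity (\int[lebesgue_measure]_x (lebesgue_Rd R d \o xsection B) (t0 - x)%R)%E.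
  apply: eq_integral => x _ /=.
  rewrite -(IH t' (xsection B (t0 - x)%R)); last exact: measurable_xsection.
  congr (lebesgue_Rd R d _).
  apply/seteqP; split => v; rewrite /xsection /= !inE /B /= consB//.
apply/esym.
refine (@integral_image _ _ (measurableTypeR R) (measurableTypeR R) R
  (@lebesgue_measure R) (@lebesgue_measure R) (fun x : R => t0 - x) _ _
  (lebesgue_Rd R d \o xsection B) _ _).
- exact: measurable_funB.
- by move=> C mCC; exact/esym/(lebesgue_measure_opp t0).
- exact: measurable_fun_xsection.
- by move=> y; exact: measure_ge0.
Qed.

(** A translation is the composite of two maps x |-> t - x. *)
Lemma lebesgue_Rd_translate d (t : 'rV[R]_d) (A : set (Rd R d)) : measurable A ->
  lebesgue_Rd R d ((fun x : Rd R d => (x : 'rV[R]_d) + t : Rd R d) @^-1` A) =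
  lebesgue_Rd R d A.
Proof.
move=> mA; rewrite -(lebesgue_Rd_opp t mA) -(lebesgue_Rd_opp 0).
  congr (lebesgue_Rd R d _); apply/seteqP.
  by split => x /=; rewrite sub0r addrC.
rewrite -[X in measurable X]setTI; apply: measurable_addr => //.
Qed.

Lemma lebesgue_Rd_set1 d (y : 'rV[R]_d) : (0 < d)%N ->
  lebesgue_Rd R d [set y : Rd R d] = 0%E.
Proof.
case: d y => // d y _.
have -> : [set y : Rd R d.+1] =
    [set v | forall i, [set y 0 i] ((v : 'rV[R]_d.+1) 0 i)].
  by apply/seteqP; split => v /= => [->//|h]; apply/rowP.
rewrite (@lebesgue_Rd_prod R d.+1 (fun i => [set y 0 i]))//.
by rewrite big_ord_recl [X in (X * _)%E]lebesgue_measure_set1 mul0e.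
Qed.

Lemma measurable_product_set d (I : 'I_d -> set R) :
  (forall i, measurable (I i)) ->
  measurable [set v : Rd R d | forall i, I i ((v : 'rV[R]_d) 0 i)].
Proof.
move=> mI.
have -> : [set v : Rd R d | forall i, I i ((v : 'rV[R]_d) 0 i)] =
    \bigcap_(i in [set: 'I_d]) ((fun v : Rd R d => (v : 'rV[R]_d) 0 i) @^-1` I i).
  by apply/seteqP; split => v /= H i; [move=> _; exact: H | exact: H].
apply: fin_bigcap_measurable => // i _.
by rewrite -[X in measurable X]setTI; apply: (measurable_coord i).
Qed.

Definition box d (a : 'I_d -> R) (h : R) : set (Rd R d) :=
  [set v | forall i, `[a i, a i + h]%classic ((v : 'rV[R]_d) 0 i)].

Lemma measurable_box d (a : 'I_d -> R) h : measurable (box a h).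
Proof. exact: (@measurable_product_set d (fun i => `[a i, a i + h]%classic)). Qed.

Lemma lebesgue_box d (a : 'I_d -> R) h : 0 <= h ->
  lebesgue_Rd R d (box a h) = (h ^+ d)%:E.
Proof.
move=> h0; rewrite /box (@lebesgue_Rd_prod R d (fun i => `[a i, a i + h]%classic))//.
rewrite (eq_bigr (fun=> h%:E)); first by rewrite prodEFin prodr_const card_ord.
move=> i _; rewrite lebesgue_measure_itv/= lte_fin ltrDl -EFinD addrC addKr.
by case: ltP => // h0'; congr EFin; apply/le_anti; rewrite h0.
Qed.

Lemma measurable_eball d (c : 'rV[R]_d) (r : R) :
  measurable (eball c r : set (Rd R d)).
Proof.
have mf : measurable_fun [set: Rd R d]
    (fun x : Rd R d => enorm ((x : 'rV[R]_d) - c)).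
  exact: (measurableT_comp (@measurable_enorm d) (measurable_addr (- c))).
rewrite (_ : eball c r = (fun x : Rd R d => enorm ((x : 'rV[R]_d) - c)) @^-1`
    `]-oo, r]%classic); last by apply/seteqP; split => x /=; rewrite in_itv.
by rewrite -[X in measurable X]setTI; exact: mf.
Qed.

Lemma lebesgue_eball_le d (c : 'rV[R]_d) (r : R) : 0 <= r ->
  (lebesgue_Rd R d (eball c r) <= ((2 * r) ^+ d)%:E)%E.
Proof.
move=> r0; rewrite -(@lebesgue_box d (fun i => c 0 i - r)) ?mulr_ge0//.
apply: le_measure; rewrite ?inE//; [exact: measurable_eball|exact: measurable_box|].
move=> x cx i; have := le_trans (coord_le_enorm (x - c) i) cx.
rewrite /= in_itv/= !mxE ler_norml => /andP[? ?]; apply/andP; split; lra.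
Qed.

Lemma lebesgue_eball_lty d (c : 'rV[R]_d) (r : R) :
  (lebesgue_Rd R d (eball c r) < +oo)%E.
Proof.
apply: (@le_lt_trans _ _ (lebesgue_Rd R d (eball c `|r|))).
  apply: le_measure; rewrite ?inE//; [exact: measurable_eball..|].
  by move=> x; rewrite /eball/= => /le_trans; apply; exact: ler_norm.
by apply: le_lt_trans (lebesgue_eball_le c (normr_ge0 r)) _; rewrite ltry.
Qed.

(** The radius d makes the ball contain a cube of side 2. *)
Lemma lebesgue_eball_gt0 d (c : 'rV[R]_d) : (0 < lebesgue_Rd R d (eball c d%:R))%E.
Proof.
apply: (@lt_le_trans _ _ (lebesgue_Rd R d (box (fun i => c 0 i - 1) 2))).
  by rewrite lebesgue_box// lte_fin exprn_gt0.
apply: le_measure; rewrite ?inE//; [exact: measurable_box|exact: measurable_eball|].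
move=> x /= Qx; rewrite /eball /= -[leRHS]mulr1; apply: enorm_le_coord => // i.
have := Qx i; rewrite /= in_itv/= !mxE ler_norml => /andP[? ?].
by apply/andP; split; lra.
Qed.

End EuclideanSpace.

Lemma mule_cancel (R : realType) (b x y : \bar R) :
  b \is a fin_num -> (0 < b)%E -> (b * x = b * y)%E -> x = y.
Proof.
move=> bfin b0 h.
by apply/le_anti/andP; split; rewrite -(lee_pmul2l bfin b0) h.
Qed.

Section Reflections.
Context (R : realType) (d : nat) (n : 'rV[R]_d) (c : R).
Hypothesis n1 : enorm n = 1.
Local Notation g := (reflection n c).

Let dotnn : dot n n = 1.
Proof. by rewrite -enorm_sqr n1 expr1n. Qed.

Lemma dot_reflection x : dot (g x) n = 2 * c - dot x n.
Proof.
by rewrite /reflection dotD -scaleNr dotZ dotnn; ring.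
Qed.

Lemma reflectionK : involutive g.
Proof.
move=> x; rewrite [LHS]/reflection dot_reflection /reflection -addrA -opprD -scalerDl.
rewrite [X in X *: n](_ : _ = 0) ?scale0r ?subr0//; ring.
Qed.

(** Translating after g amounts to translating by the linear part of g before it. *)
Lemma reflection_sub x y :
  g y - x = g (y - (x - (2 * dot x n) *: n)).
Proof.
apply/rowP => i; rewrite /reflection !(dotD, dotN, dotZ) dotnn !mxE; ring.
Qed.

Lemma reflection_isometry x y : enorm (g x - g y) = enorm (x - y).
Proof.
have -> : g x - g y = (x - y) + (- (2 * dot (x - y) n)) *: n.
  by apply/rowP => i; rewrite /reflection dotD dotN !mxE; ring.
rewrite /enorm; congr Num.sqrt; move: (x - y) => z.
rewrite dotD dotZ (dotC z) (dotC n) !dotD !dotZ dotnn (dotC n z); ring.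
Qed.

Lemma reflection_center : g (c *: n) = c *: n.
Proof. by rewrite /reflection dotZ dotnn mulr1 subrr mulr0 scale0r subr0. Qed.

Lemma measurable_reflection :
  measurable_fun [set: Rd R d] (g : Rd R d -> Rd R d).
Proof.
apply: measurable_rV => i; rewrite /reflection.
under eq_fun do rewrite 3!mxE.
apply: measurable_funB; first exact: (measurable_coord i).
apply: measurable_funM => //; apply: measurable_funM => //.
by apply: measurable_funB => //; exact: measurable_dot.
Qed.

Let L := lebesgue_Rd R d.
Let shift x : set (Rd R d) -> set (Rd R d) :=
  fun B => [set y | B (g y - (x : 'rV[R]_d))].

Let measurable_shift :
  measurable_fun [set: Rd R d * Rd R d]
    (fun p => g (p.2 : 'rV[R]_d) - (p.1 : 'rV[R]_d) : Rd R d).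
Proof.
have m2 : measurable_fun [set: Rd R d * Rd R d]
    (fun p => (g (p.2 : 'rV[R]_d) : Rd R d, p.1)).
  apply: measurable_fun_pair; last exact: measurable_fst.
  exact: (measurableT_comp measurable_reflection measurable_snd).
exact: (measurableT_comp (@measurable_sub R d) m2).
Qed.

Let mshift x B : measurable B -> measurable (shift x B).
Proof.
move=> mB.
have -> : shift x B = xsection [set p : Rd R d * Rd R d |
    B (g (p.2 : 'rV[R]_d) - (p.1 : 'rV[R]_d))] x.
  by apply/seteqP; split => y; rewrite /xsection /= inE.
apply: measurable_xsection.
by rewrite -[X in measurable X]setTI; exact: measurable_shift.
Qed.

Let mpre B : measurable B -> measurable ((g : Rd R d -> Rd R d) @^-1` B).
Proof.
by move=> mB; rewrite -[X in measurable X]setTI; exact: measurable_reflection.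
Qed.

Let lebesgue_shift x B : measurable B -> L (shift x B) = L (g @^-1` B).
Proof.
move=> mB; rewrite /L -(lebesgue_Rd_translate (- (x - (2 * dot x n) *: n)) (mpre mB)).
by congr (lebesgue_Rd R d _); apply/seteqP; split => y /=; rewrite /shift/= reflection_sub.
Qed.

Let mind A : measurable A -> measurable_fun [set: Rd R d] (\1_A : Rd R d -> R).
Proof. exact: measurable_indic. Qed.

Let F (A B : set (Rd R d)) (p : Rd R d * Rd R d) : \bar R :=
  ((\1_A p.1 : R)%:E * (\1_B (g (p.2 : 'rV[R]_d) - (p.1 : 'rV[R]_d) : Rd R d))%:E)%E.

Let mF A B : measurable A -> measurable B -> measurable_fun setT (F A B).
Proof.
move=> mA mB; apply: emeasurable_funM; apply/measurable_EFinP.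
  exact: (measurableT_comp (mind mA) measurable_fst).
exact: (measurableT_comp (mind mB) measurable_shift).
Qed.

Let F0 A B p : (0 <= F A B p)%E.
Proof. by rewrite mule_ge0// lee_fin. Qed.

Let integral_F A B : measurable A -> measurable B ->
  (\int[L]_x \int[L]_y F A B (x, y) = L A * L (g @^-1` B))%E.
Proof.
move=> mA mB.
transitivity (\int[L]_x ((\1_A x)%:E * L (g @^-1` B)))%E.
  apply: eq_integral => x _; rewrite /F /=.
  rewrite ge0_integralZl ?lee_fin//.
    congr (_ * _)%E.
    transitivity (\int[L]_y (\1_(shift x B) y)%:E)%E.
      exact: eq_integral.
    rewrite integral_indic ?setIT; [exact: lebesgue_shift|by []|exact: mshift].
  apply/measurable_EFinP.
  exact: (mind (mshift x mB)).
rewrite ge0_integralZr//; last exact/measurable_EFinP/measurable_indic.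
by rewrite integral_indic// setIT.
Qed.

(** The uniqueness argument for the Haar measure: the double integral of
    1_A(x) 1_B(g y - x) is symmetric in A and B, as x |-> g y - x preserves L. *)
Let symmetric_F (A B : set (Rd R d)) : measurable A -> measurable B ->
  (L A * L (g @^-1` B) = L B * L (g @^-1` A))%E.
Proof.
move=> mA mB.
have fub (A' B' : set (Rd R d)) : measurable A' -> measurable B' ->
    (L A' * L (g @^-1` B') = \int[L]_y \int[L]_x F A' B' (x, y))%E.
  move=> mA' mB'; rewrite -(integral_F mA' mB').
  exact: (@fubini_tonelli _ _ _ _ _ L L (F A' B') (mF mA' mB') (F0 A' B')).
rewrite (fub _ _ mA mB) (fub _ _ mB mA).
apply: eq_integral => y _.
have mG D : measurable D -> measurable_fun [set: Rd R d]
    (fun x : Rd R d => \1_D (g (y : 'rV[R]_d) - (x : 'rV[R]_d) : Rd R d) : R).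
  move=> mD.
  exact: (measurableT_comp (mind mD) (@measurable_subl R d (g y))).
have mFy : measurable_fun [set: Rd R d] (fun x => F A B (x, y)).
  apply: emeasurable_funM; apply/measurable_EFinP; first exact: mind.
  exact: mG.
have LE D : measurable D -> L D = L ((fun x : Rd R d =>
    g (y : 'rV[R]_d) - (x : 'rV[R]_d) : Rd R d) @^-1` D).
  by move=> mD; rewrite /L lebesgue_Rd_opp.
rewrite (integral_image (@measurable_subl R d (g y)) LE mFy (fun x => F0 A B (x, y))).
apply: eq_integral => x _; rewrite /F /= muleC.
by rewrite opprB addrC subrK.
Qed.

(** The factor is found to be 1 on a ball that g maps to itself. *)
Lemma lebesgue_Rd_reflection (A : set (Rd R d)) : measurable A ->
  lebesgue_Rd R d (g @^-1` A) = lebesgue_Rd R d A.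
Proof.
rewrite -/L => mA; pose B : set (Rd R d) := eball (c *: n) d%:R.
have mB : measurable B by exact: measurable_eball.
have gB : g @^-1` B = B.
  apply/seteqP; rewrite /B /eball; split => x /=.
    by rewrite -[in X in X -> _]reflection_center reflection_isometry.
  by rewrite -[in X in _ -> X]reflection_center reflection_isometry.
have := symmetric_F mA mB; rewrite gB muleC => h.
have B0 : (0 < L B)%E by exact: lebesgue_eball_gt0.
have Boo : (L B < +oo)%E by exact: lebesgue_eball_lty.
have Bfin : L B \is a fin_num by rewrite ge0_fin_numE.
exact: (esym (mule_cancel Bfin B0 h)).
Qed.

End Reflections.

(** * Integrability of the kernel near the origin *)

Section RadialKernel.
Context (R : realType) (d : nat) (K : R -> R) (hd : (0 < d)%N) (hK : condK d K).
Local Notation L := (lebesgue_Rd R d).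

(** K is constrained on (0,+oo) only; extended by 0 it becomes nonnegative and
    Borel on the whole line. *)
Definition kernel_on_pos (r : R) : R := if 0 < r then K r else 0.
Local Notation K0 := kernel_on_pos.

Lemma kernel_ge0 r : 0 <= K0 r.
Proof. by rewrite /K0; case: ifPn => // r0; case: hK => h _ _ _ _; exact: h. Qed.

Lemma kernel_le r s : 0 < r -> r <= s -> K0 s <= K0 r.
Proof.
move=> r0 rs; have s0 : 0 < s by exact: lt_le_trans rs.
rewrite /K0 r0 s0; case: hK => _ _ h _ _; apply: h => //; by rewrite in_itv/= ?r0 ?s0.
Qed.

Lemma measurable_kernel : measurable_fun [set: R] K0.
Proof.
apply: (measurability (@RGenCInfty.G R)) => [|/= _ [_] [r] -> <-].
  exact: RGenCInfty.measurableE.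
rewrite setTI; have [r0|r0] := leP r 0.
  rewrite (_ : _ @^-1` _ = setT); first exact: measurableT.
  apply/seteqP; split => // x _; rewrite /= in_itv/= andbT.
  by rewrite (le_trans r0)// kernel_ge0.
apply: is_interval_measurable => s t /=.
rewrite !in_itv/= !andbT => Ks Kt u /andP[su ut].
have s0 : 0 < s.
  by move: Ks; rewrite /K0; case: ifPn => // _; rewrite leNgt r0.
by rewrite in_itv/= andbT (le_trans Kt)// kernel_le// (lt_le_trans s0).
Qed.

Definition radial (z : Rd R d) : R := K0 (enorm (z : 'rV[R]_d)).

Lemma measurable_radial : measurable_fun [set: Rd R d] radial.
Proof. exact: (measurableT_comp measurable_kernel (@measurable_enorm R d)). Qed.

Let x_ (k : nat) : R := 2^-1 ^+ k.
Let x_gt0 k : 0 < x_ k.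
Proof. by rewrite exprn_gt0. Qed.
Let x_S k : x_ k.+1 = x_ k / 2.
Proof. by rewrite /x_ exprSr. Qed.
Let x_le m n : (m <= n)%N -> x_ n <= x_ m.
Proof. by move=> mn; rewrite /x_; apply: ler_wiXn2l => //; rewrite invf_le1// ler1n. Qed.
Let x_cvg r : 0 < r -> exists k, x_ k < r.
Proof.
move=> r0; have : x_ @ \oo --> (0 : R).
  by apply: cvg_expr; rewrite ger0_norm ?invf_lt1// ltr1n.
move=> /cvgrPdist_lt /(_ _ r0)[k _ /(_ k (leqnn k))] /=.
by rewrite sub0r normrN ger0_norm ?ltW// => h; exists k.
Qed.

(** Dyadic shells serve twice: for z |-> |z| on R^d, and for r |-> 2r on the line,
    where the factor 2 shifts the shells so that the k-th one lies below x_(k+1),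
    the inner radius of the k-th shell of R^d. *)
Let shell T (f : T -> R) (k : nat) : set T := [set z | x_ k.+1 < f z <= x_ k].
Let shell_triv T (f : T -> R) : trivIset setT (shell f).
Proof.
have main i j z : (i < j)%N -> shell f i z -> shell f j z -> False.
  move=> ij /andP[h _] /andP[_ h']; have := lt_le_trans h h'.
  by rewrite ltNge x_le.
apply/trivIsetP => i j _ _ ij; apply/seteqP; split => // z [zi zj].
by move: ij; rewrite neq_ltn => /orP[] ij; [apply: (main _ _ z ij)|apply: (main _ _ z ij)].
Qed.
Let shell_cover T (f : T -> R) z : 0 < f z <= 1 -> (\bigcup_k shell f k) z.
Proof.
move=> /andP[f0 f1]; have [k0 h0] := x_cvg f0.
have ex : exists k, x_ k < f z by exists k0.
have := ex_minnP ex => -[[|k] xk kmin].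
  by move: xk; rewrite /x_ expr0 ltNge f1.
exists k => //; apply/andP; split => //.
by rewrite leNgt; apply/negP => /kmin; rewrite ltnn.
Qed.
Let measurable_shell d' (T : measurableType d') (f : T -> R) k :
  measurable_fun setT f -> measurable (shell f k).
Proof.
move=> mf; rewrite (_ : shell f k = f @^-1` `]x_ k.+1, x_ k]%classic).
  by rewrite -[X in measurable X]setTI; exact: mf.
by apply/seteqP; split => z; rewrite /shell /= in_itv.
Qed.

Let kz (z : Rd R d) : \bar R := (radial z)%:E.
Let fr (r : R) : \bar R := `|(r ^+ d.-1 * K r)%:E|%E.

Let A_ := shell (fun z : Rd R d => enorm (z : 'rV[R]_d)).
Let J_ k : set R := shell (fun r : R => 2 * r) k.

(** On the k-th shell of R^d the kernel is at most its value at the inner radius. *)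
Let A_le k : (\int[L]_(z in A_ k) kz z <= (K (x_ k.+1) * (2 * x_ k) ^+ d)%:E)%E.
Proof.
have mA : measurable (A_ k) by apply: measurable_shell; exact: measurable_enorm.
have Kx0 : 0 <= K (x_ k.+1) by case: hK => h _ _ _ _; exact: h.
apply: (@le_trans _ _ (\int[L]_(z in A_ k) cst (K (x_ k.+1))%:E z)%E).
  apply: ge0_le_integral => //.
  - by move=> z _; rewrite lee_fin kernel_ge0.
  - by apply: measurable_funTS; apply/measurable_EFinP; exact: measurable_radial.
  - move=> z /andP[z1 _]; rewrite lee_fin.
    have := kernel_le (x_gt0 k.+1) (ltW z1); rewrite /radial {2}/K0 x_gt0.
    exact.
rewrite integral_cst// EFinM; apply: lee_wpmul2l; first by rewrite lee_fin.
apply: le_trans (lebesgue_eball_le 0 (ltW (x_gt0 k))).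
apply: le_measure; rewrite ?inE//; first exact: measurable_eball.
by move=> z /andP[_ z1]; rewrite /eball /= subr0.
Qed.

Let measurable_J k : measurable (J_ k).
Proof. by apply: measurable_shell; exact: measurable_funM. Qed.

Let JE k : J_ k = `]x_ k.+2, x_ k.+1]%classic.
Proof.
apply/seteqP; split => r; rewrite /J_ /shell /= in_itv/= !x_S => /andP[? ?];
  apply/andP; split; lra.
Qed.

Let I01 : set R := `[0, 1]%classic.

Let J_sub : \bigcup_k J_ k `<=` I01.
Proof.
move=> r [k _]; rewrite JE /I01 /= !in_itv/= => /andP[h1 h2]; apply/andP; split.
  by rewrite ltW// (lt_trans _ h1).
by rewrite (le_trans h2)// -[leRHS]/(x_ 0) x_le.
Qed.

Let fr_integrable :
  lebesgue_measure.-integrable I01 (fun r : R => (r ^+ d.-1 * K r)%:E).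
Proof.
case: hK => _ h _ _ _; apply: h; first exact: segment_compact.
by move=> r; rewrite /I01 /= !in_itv/= andbT => /andP[].
Qed.

Let fr_int : (\int[lebesgue_measure]_(r in I01) fr r < +oo)%E.
Proof.
by have /integrableP[_] := fr_integrable.
Qed.

Let measurable_fr : measurable_fun I01 fr.
Proof.
have /integrableP[mf _] := fr_integrable; exact: measurableT_comp.
Qed.

(** On the k-th interval the kernel is at least its value at the right endpoint,
    which is that same inner radius. *)
Let J_ge k : ((K (x_ k.+1) * x_ k.+2 ^+ d)%:E <= \int[lebesgue_measure]_(r in J_ k) fr r)%E.
Proof.
have Kx0 : 0 <= K (x_ k.+1) by case: hK => h _ _ _ _; exact: h.
have LJ : lebesgue_measure (J_ k) = (x_ k.+2)%:E.
  rewrite JE lebesgue_measure_itv/= lte_fin.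
  have -> : x_ k.+2 < x_ k.+1 by rewrite (x_S k.+1); have := x_gt0 k.+1; lra.
  by rewrite -EFinB; congr EFin; rewrite (x_S k.+1); lra.
have subJ : J_ k `<=` I01 by move=> r Jr; apply: J_sub; exists k.
apply: (@le_trans _ _ (\int[lebesgue_measure]_(r in J_ k)
    cst (x_ k.+2 ^+ d.-1 * K (x_ k.+1))%:E r)%E).
  have -> (e : \bar R) : (\int[lebesgue_measure]_(r in J_ k) cst e r
      = e * lebesgue_measure (J_ k))%E.
    by apply: integral_cst; exact: measurable_J.
  rewrite LJ -EFinM lee_fin.
  by rewrite -{1}(prednK hd) exprS mulrC -mulrA mulrC -mulrA.
apply: ge0_le_integral => //.
- exact: measurable_J.
- by move=> r _; rewrite lee_fin mulr_ge0// exprn_ge0// ltW.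
- by apply: (measurable_funS _ subJ measurable_fr); exact: measurable_itv.
- move=> r; rewrite JE /= in_itv/= => /andP[h1 h2].
  have r0 : 0 < r by rewrite (lt_trans _ h1).
  have Kr : K (x_ k.+1) <= K r.
    by have := kernel_le r0 h2; rewrite /K0 r0 x_gt0.
  rewrite /fr /= lee_fin ger0_norm; last first.
    by apply: mulr_ge0; [apply: exprn_ge0; exact: ltW|exact: le_trans Kr].
  apply: ler_pM => //; first by apply: exprn_ge0; exact: ltW.
  by apply: lerXn2r; rewrite ?nnegrE; exact: ltW.
Qed.

(** Summing the two estimates over k; the ratio of (2 x_k)^d to x_(k+2)^d is 8^d. *)
Lemma radial_integrable_ball :
  (\int[L]_(z in eball 0 1) (radial z)%:E < +oo)%E.
Proof.
have mA k : measurable (A_ k) by apply: measurable_shell; exact: measurable_enorm.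
have mkz : measurable_fun setT kz by apply/measurable_EFinP; exact: measurable_radial.
have kz0 z : (0 <= kz z)%E by rewrite lee_fin kernel_ge0.
have -> : (\int[L]_(z in eball 0 1) (radial z)%:E = \int[L]_(z in \bigcup_k A_ k) kz z)%E.
  rewrite integral_mkcond [in RHS]integral_mkcond; apply: eq_integral => z _.
  rewrite !patchE; case: ifPn => hz; case: ifPn => hz' //.
  - move: hz hz'; rewrite inE notin_setE /eball /= subr0 => z1 nz.
    rewrite /radial /K0; case: ifPn => // z0; exfalso; apply: nz.
    by apply: shell_cover; rewrite z0.
  - move: hz hz'; rewrite inE notin_setE /eball /= subr0 => z1 [k _ /andP[_ zk]].
    exfalso; apply: z1; rewrite (le_trans zk)// -[leRHS]/(x_ 0) x_le//.
rewrite ge0_integral_bigcup//; [|exact: measurable_funTS|exact: shell_triv].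
apply: (@le_lt_trans _ _ (\sum_(0 <= k <oo)
   ((8 ^+ d)%:E * \int[lebesgue_measure]_(r in J_ k) fr r))%E).
  apply: lee_nneseries => [k _ _|k _]; first by apply: integral_ge0 => z _; exact: kz0.
  apply: (le_trans (A_le k)).
  have -> : K (x_ k.+1) * (2 * x_ k) ^+ d = 8 ^+ d * (K (x_ k.+1) * x_ k.+2 ^+ d).
    rewrite mulrCA -exprMn; congr (_ * _ ^+ _); rewrite !x_S; lra.
  rewrite EFinM; apply: lee_wpmul2l; first by rewrite lee_fin exprn_ge0.
  exact: J_ge.
rewrite nneseriesZl; last by move=> k _; apply: integral_ge0 => x _; exact: abse_ge0.
have -> : (\sum_(0 <= i <oo) \int[lebesgue_measure]_(r in J_ i) fr r
    = \int[lebesgue_measure]_(r in \bigcup_k J_ k) fr r)%E.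
  apply/esym; apply: ge0_integral_bigcup.
  - exact: measurable_J.
  - by apply: (measurable_funS _ J_sub measurable_fr); exact: measurable_itv.
  - by move=> r _; exact: abse_ge0.
  - exact: shell_triv.
apply: lte_mul_pinfty; rewrite ?lee_fin ?exprn_ge0//.
apply: le_lt_trans fr_int; apply: ge0_subset_integral => //.
- by apply: bigcupT_measurable => k; exact: measurable_J.
- exact: measurable_itv.
- by move=> r _; exact: abse_ge0.
Qed.

End RadialKernel.

(** * Interaction energy of measures below rho times Lebesgue measure *)

Section Interaction.
Context (R : realType) (d : nat) (k : Rd R d -> R) (M rho : R).
Local Notation L := (lebesgue_Rd R d).
Hypotheses (mk : measurable_fun [set: Rd R d] k) (k_ge0 : forall z, 0 <= k z).
Hypothesis k_ball : (\int[L]_(z in eball 0 1) (k z)%:E < +oo)%E.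
Hypotheses (M0 : 0 <= M) (k_far : forall z : Rd R d, 1 < enorm (z : 'rV[R]_d) -> k z <= M).
Hypothesis rho0 : 0 < rho.

(** The level starts at M, the bound of k away from the unit ball, so that the
    truncated part lives in that ball for every n. *)
Definition truncation (n : nat) (z : Rd R d) : R := Num.min (k z) (M + n%:R).
Definition tail (n : nat) (z : Rd R d) : R := k z - truncation n z.

Lemma truncation_bounds n z : 0 <= truncation n z <= M + n%:R.
Proof.
have ? : 0 <= M + n%:R by rewrite addr_ge0.
by rewrite /truncation le_min k_ge0 ge_min lexx orbT; apply/andP.
Qed.

Lemma measurable_truncation n : measurable_fun [set: Rd R d] (truncation n).
Proof. by apply: measurable_minr. Qed.

Lemma measurable_tail n : measurable_fun [set: Rd R d] (tail n).
Proof. apply: measurable_funB => //; exact: measurable_truncation. Qed.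

Lemma tail_ge0 n z : 0 <= tail n z.
Proof. by rewrite subr_ge0 /truncation ge_min lexx. Qed.

(** Dominated convergence, with k restricted to the unit ball as dominating
    function. *)
Lemma integral_tail_cvg0 : (\int[L]_z (tail n z)%:E)%E @[n --> \oo] --> 0%E.
Proof.
pose B : set (Rd R d) := eball 0 1.
have mB : measurable B by exact: measurable_eball.
pose g (z : Rd R d) : \bar R := ((fun z => (k z)%:E) \_ B) z.
have mg : measurable_fun setT g.
  apply/(measurable_restrictT _ mB)/measurable_funTS; exact/measurable_EFinP.
have tail_g n z : (`|(tail n z)%:E| <= g z)%E.
  rewrite gee0_abs ?lee_fin ?tail_ge0// /g patchE; case: ifPn => zB.
    by rewrite lee_fin /tail lerBlDr lerDl; have /andP[] := truncation_bounds n z.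
  move: zB; rewrite notin_setE /B /eball /= subr0 => /negP; rewrite -ltNge => z1.
  rewrite /tail /truncation lee_fin min_l ?subrr//.
  by rewrite (le_trans (k_far z1))// lerDl.
have ig : L.-integrable setT g.
  apply/integrableP; split => //.
  have -> : (\int[L]_z `|g z| = \int[L]_(z in B) (k z)%:E)%E.
    rewrite [RHS]integral_mkcond; apply: eq_integral => z _.
    by rewrite gee0_abs// /g patchE; case: ifPn => // _; rewrite lee_fin.
  exact: k_ball.
have cv z : (tail n z)%:E @[n --> \oo] --> (cst 0%E z : \bar R).
  apply: cvg_near_cst; exists (Num.truncn (k z)).+1 => // n /= zn.
  rewrite /tail /truncation min_l ?subrr//.
  apply: (@le_trans _ _ n%:R); last by rewrite lerDr.
  by rewrite (le_trans (ltW (truncnS_gt _)))// ler_nat.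
have mt n : measurable_fun setT (fun z => (tail n z)%:E).
  by apply/measurable_EFinP; exact: measurable_tail.
have [_ _] := @dominated_convergence _ _ _ L setT measurableT
  (fun n z => (tail n z)%:E) (cst 0%E) g mt (measurable_cst _)
  (aeW _ (fun z _ => cv z)) ig (aeW _ (fun z n _ => tail_g n z)).
by rewrite integral0.
Qed.

Definition below (m : set (Rd R d) -> \bar R) :=
  forall A, measurable A -> (m A <= rho%:E * L A)%E.

Lemma below_integral (m : {measure set (Rd R d) -> \bar R}) (h : Rd R d -> \bar R) :
  below m -> measurable_fun [set: Rd R d] h -> (forall x, 0 <= h x)%E ->
  (\int[m]_x h x <= rho%:E * \int[L]_x h x)%E.
Proof.
move=> bm mh h0.
rewrite -(ge0_integral_mscale L measurableT (NngNum (ltW rho0)) mh) /=; last by [].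
exact: ge0_le_measure_integral.
Qed.

Lemma below_potential (m : {measure set (Rd R d) -> \bar R}) (h : Rd R d -> \bar R) (y : 'rV[R]_d) :
  below m -> measurable_fun [set: Rd R d] h -> (forall x, 0 <= h x)%E ->
  (\int[m]_x h ((x : 'rV[R]_d) - y : Rd R d)%R <= rho%:E * \int[L]_x h x)%E.
Proof.
move=> bm mh h0.
have mD : measurable_fun [set: Rd R d] (fun x : Rd R d => (x : 'rV[R]_d) - y : Rd R d).
  exact: measurable_addr.
apply: le_trans (below_integral bm _ _) _ => //.
  exact: (measurableT_comp mh mD).
by rewrite -(integral_image mD
  (fun A mA => esym (lebesgue_Rd_translate (- y) mA)) mh h0).
Qed.

Definition difference (p : Rd R d * Rd R d) : Rd R d :=
  (p.1 : 'rV[R]_d) - (p.2 : 'rV[R]_d).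

Definition interaction (h : Rd R d -> R) (m : set (Rd R d) -> \bar R) : \bar R :=
  (\int[m]_y \int[m]_x (h ((x : 'rV[R]_d) - (y : 'rV[R]_d) : Rd R d))%:E)%E.

Lemma measurable_pair_kernel (h : Rd R d -> R) : measurable_fun [set: Rd R d] h ->
  measurable_fun [set: Rd R d * Rd R d] (fun p => (h (difference p))%:E).
Proof.
move=> mh; apply/measurable_EFinP; exact: (measurableT_comp mh (@measurable_sub R d)).
Qed.

Lemma interactionE (h : Rd R d -> R) (m : probability (Rd R d) R) :
  measurable_fun [set: Rd R d] h -> (forall x, 0 <= h x) ->
  interaction h m = (\int[m \x m]_p (h (difference p))%:E)%E.
Proof.
move=> mh h0; rewrite /interaction.
rewrite (@fubini_tonelli2 _ _ _ _ _ m m (fun p => (h (difference p))%:E))//.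
  exact: measurable_pair_kernel.
by move=> p; rewrite lee_fin.
Qed.

Lemma measurable_potential (h : Rd R d -> R) (m : probability (Rd R d) R) :
  measurable_fun [set: Rd R d] h -> (forall x, 0 <= h x) ->
  measurable_fun [set: Rd R d]
    (fun y => \int[m]_x (h ((x : 'rV[R]_d) - (y : 'rV[R]_d) : Rd R d))%:E)%E.
Proof.
move=> mh h0.
apply: (@measurable_fun_fubini_tonelli_G _ _ _ _ _ m (fun p => (h (difference p))%:E)) => //.
  exact: measurable_pair_kernel.
by move=> p; rewrite lee_fin.
Qed.

(** The potential of the tail is bounded by rho times its Lebesgue integral, at
    every point. *)
Lemma interaction_truncation (m : probability (Rd R d) R) n : below m ->
  (interaction k m <= interaction (truncation n) m + rho%:E * \int[L]_z (tail n z)%:E)%E.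
Proof.
move=> bm.
have mtr := measurable_truncation n; have mt := measurable_tail n.
have tr0 z : 0 <= truncation n z by have /andP[] := truncation_bounds n z.
have t0 := tail_ge0 n.
have mdiff y : measurable_fun [set: Rd R d]
    (fun x : Rd R d => (x : 'rV[R]_d) - (y : 'rV[R]_d) : Rd R d).
  exact: measurable_addr.
have -> : interaction k m = (interaction (truncation n) m + interaction (tail n) m)%E.
  rewrite /interaction -ge0_integralD//; last 4 first.
  - by move=> y _; apply: integral_ge0 => x _; rewrite lee_fin.
  - exact: measurable_potential.
  - by move=> y _; apply: integral_ge0 => x _; rewrite lee_fin.
  - exact: measurable_potential.
  apply: eq_integral => y _; rewrite -ge0_integralD//.
  - by apply: eq_integral => x _; rewrite -EFinD /tail subrKC.
  - by move=> x _; rewrite lee_fin.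
  - by apply/measurable_EFinP; exact: (measurableT_comp mtr (mdiff y)).
  - by move=> x _; rewrite lee_fin.
  - by apply/measurable_EFinP; exact: (measurableT_comp mt (mdiff y)).
apply: leeD => //; rewrite /interaction.
set c := (rho%:E * _)%E.
have -> : c = (\int[m]_y cst c y)%E by rewrite integral_cst//= probability_setT mule1.
apply: ge0_le_integral => //.
- by move=> y _; apply: integral_ge0 => x _; rewrite lee_fin.
- exact: measurable_potential.
- move=> y _ /=.
  apply: (@below_potential m (fun z => (tail n z)%:E) y bm) => //.
  exact/measurable_EFinP.
Qed.

Lemma interaction_truncation_le (m : probability (Rd R d) R) n :
  interaction (truncation n) m \is a fin_num /\
  0 <= fine (interaction (truncation n) m) <= M + n%:R.
Proof.
have mtr := measurable_truncation n.
have tr0 z : 0 <= truncation n z by have /andP[] := truncation_bounds n z.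
rewrite interactionE//.
apply: (prob_integral_bounded (m \x m)%E).
  exact: (measurableT_comp mtr (@measurable_sub R d)).
by move=> p; exact: truncation_bounds.
Qed.

Lemma integral_tail_lty n : (\int[L]_z (tail n z)%:E < +oo)%E.
Proof.
pose B : set (Rd R d) := eball 0 1.
have mB : measurable B by exact: measurable_eball.
apply: le_lt_trans k_ball.
rewrite [leRHS]integral_mkcond; apply: ge0_le_integral => //.
- by move=> z _; rewrite lee_fin tail_ge0.
- by apply/measurable_EFinP; exact: measurable_tail.
- apply/(measurable_restrictT _ mB)/measurable_funTS; exact/measurable_EFinP.
- move=> z _; rewrite patchE; case: ifPn => zB.
    by rewrite lee_fin /tail lerBlDr lerDl; have /andP[] := truncation_bounds n z.
  move: zB; rewrite notin_setE /B /eball /= subr0 => /negP; rewrite -ltNge => z1.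
  rewrite /tail /truncation lee_fin min_l ?subrr//.
  by rewrite (le_trans (k_far z1))// lerDl.
Qed.

Lemma interaction_bounded : exists c : R, forall m : probability (Rd R d) R, below m ->
  (0 <= interaction k m <= c%:E)%E.
Proof.
have t0 : (0 <= \int[L]_z (tail 0 z)%:E)%E.
  by apply: integral_ge0 => z _; rewrite lee_fin tail_ge0.
exists (M + 0%:R + rho * fine (\int[L]_z (tail 0 z)%:E)%E) => m bm.
apply/andP; split.
  by apply: integral_ge0 => y _; apply: integral_ge0 => x _; rewrite lee_fin.
apply: le_trans (interaction_truncation 0 bm) _.
have [fi /andP[_ h]] := interaction_truncation_le m 0.
rewrite EFinD EFinM fineK; last by rewrite ge0_fin_numE// integral_tail_lty.
by apply: leeD => //; rewrite -(fineK fi) lee_fin.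
Qed.

End Interaction.

(** * Admissible measures and their energy *)

Section Admissible.
Context (R : realType) (d : nat) (rho : R) (hrho : 0 < rho).
Local Notation L := (lebesgue_Rd R d).

(** Truncating to [0, rho] changes a density on a null set only, and a pointwise
    bound is easier to carry through rearrangements and weak limits. *)
Lemma P2r_density (m : probability (Rd R d) R) : P2r rho m ->
  exists g : Rd R d -> R, [/\ measurable_fun [set: Rd R d] g,
    forall x, 0 <= g x <= rho &
    forall A, measurable A -> m A = (\int[L]_(x in A) (g x)%:E)%E].
Proof.
move=> [_ [f [g [mg fg mE]] f0]].
pose g' x := Num.max 0 (Num.min (g x) rho).
have mg' : measurable_fun setT g'.
  by apply: measurable_maxr => //; apply: measurable_minr.
exists g'; split => //.
  move=> x; rewrite /g' le_max lexx/= ge_max (ltW hrho)/=.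
  by rewrite ge_min lexx orbT.
move=> A mA; rewrite mE//; apply: ae_eq_integral => //.
- by apply: measurable_funTS; apply/measurable_EFinP.
- by apply: measurable_funTS; apply/measurable_EFinP.
apply: filterS2 f0 fg => x fx0 fgx _.
move: fx0; rewrite fgx => /andP[g0 g1].
by rewrite /g' min_l// max_r.
Qed.

Lemma P2r_below (m : probability (Rd R d) R) : P2r rho m -> below rho m.
Proof.
move=> /P2r_density[g [mg g01 mE]] A mA; rewrite mE//.
rewrite -integral_cst//; apply: ge0_le_integral => //.
- by move=> x _; rewrite lee_fin; have /andP[] := g01 x.
- by apply: measurable_funTS; apply/measurable_EFinP.
- by move=> x _; rewrite lee_fin; have /andP[] := g01 x.
Qed.

(** A Radon-Nikodym density f cannot exceed rho + 1/(j+1) on a set A of positive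
    measure, as m(A) would then exceed rho L(A). *)
Lemma below_density (m : probability (Rd R d) R) : below rho m ->
  exists2 f : Rd R d -> R, has_density m f &
    {ae L, forall x, 0 <= f x <= rho}.
Proof.
move=> bm.
have dom : m `<< L.
  apply/null_content_dominatesP => A mA LA0.
  by apply/eqP; rewrite eq_le measure_ge0 andbT (le_trans (bm _ mA))// LA0 mule0.
have f0 := Radon_Nikodym_SigmaFinite.f_ge0 dom.
have fint := Radon_Nikodym_SigmaFinite.f_integrable dom.
have ffin := Radon_Nikodym_SigmaFinite.f_fin_num dom.
have fE A (mA : measurable A) := Radon_Nikodym_SigmaFinite.f_integral dom mA.
move: f0 fint ffin fE; set f := Radon_Nikodym_SigmaFinite.f _ _ => f0 fint ffin fE.
have mf : measurable_fun setT f by case/integrableP: fint.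
pose g x := fine (f x).
have gE x : (g x)%:E = f x by rewrite /g fineK.
have mg : measurable_fun setT g.
  by apply/measurable_EFinP; rewrite (_ : EFin \o g = f)//; apply/funext => x /=.
have g0 x : 0 <= g x by rewrite -lee_fin gE.
have gmE A : measurable A -> m A = (\int[L]_(x in A) (g x)%:E)%E.
  by move=> mA; rewrite fE//; apply: eq_integral => x _; rewrite gE.
exists g; first by exists g; split => //; exact: aeW.
pose A (j : nat) := [set x | rho + j.+1%:R^-1 <= g x].
have mA j : measurable (A j).
  rewrite (_ : A j = g @^-1` `[rho + j.+1%:R^-1, +oo[%classic).
    by rewrite -[X in measurable X]setTI; exact: mg.
  by apply/seteqP; split => x; rewrite /A /= in_itv/= andbT.
have A0 j : L (A j) = 0%E.
  have j0 : 0 < j.+1%:R^-1 :> R by rewrite invr_gt0.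
  have h1 : ((rho + j.+1%:R^-1)%:E * L (A j) <= m (A j))%E.
    rewrite gmE// -integral_cst//; apply: ge0_le_integral => //.
    - by move=> x _; rewrite lee_fin addr_ge0// ltW.
    - by apply: measurable_funTS; apply/measurable_EFinP.
  have h2 := bm _ (mA j).
  have Lfin : L (A j) \is a fin_num.
    rewrite ge0_fin_numE// ltNge; apply/negP; rewrite leye_eq => /eqP Loo.
    move: h1; rewrite Loo gt0_muley; last by rewrite lte_fin addr_gt0.
    rewrite leye_eq => /eqP moo; have := probability_le1 m (mA j).
    by rewrite moo.
  move: (le_trans h1 h2); rewrite -(fineK Lfin) -!EFinM lee_fin mulrDl gerDl.
  rewrite pmulr_rle0// => h; congr EFin; apply/eqP.
  by rewrite eq_le h fine_ge0.
have : L.-negligible (\bigcup_j A j).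
  apply: negligible_bigcup => j; exists (A j); split; [exact: mA|exact: A0|by []].
apply: negligibleS => x /= nx.
have gx : rho < g x.
  by rewrite ltNge; apply/negP => h; apply: nx; rewrite g0.
have d0 : 0 < g x - rho by rewrite subr_gt0.
exists (Num.truncn (g x - rho)^-1) => //.
rewrite /A /= -lerBrDl.
rewrite -[leRHS]invrK lef_pV2 ?posrE ?invr_gt0//.
by rewrite ltW// truncnS_gt.
Qed.

Lemma below_P2r (m : probability (Rd R d) R) : P2 m -> below rho m -> P2r rho m.
Proof. by move=> Pm bm; split => //; exact: below_density. Qed.

End Admissible.

Section EnergyOfMeasures.
Context (R : realType) (d : nat) (rho : R) (W : 'rV[R]_d -> R) (K : R -> R).
Hypotheses (hd : (0 < d)%N) (hrho : 0 < rho) (hW : condW W) (hK : condK d K).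
Local Notation L := (lebesgue_Rd R d).
Local Notation k := (@radial R d K).

Lemma measurable_W : measurable_fun [set: Rd R d] W.
Proof. by apply: measurable_continuous; case: hW. Qed.

Lemma W_ge0 x : 0 <= W x.
Proof. by case: hW. Qed.

Lemma measurable_set1_Rd (y : 'rV[R]_d) : measurable [set y : Rd R d].
Proof.
rewrite (_ : [set y : Rd R d] = eball y 0); first exact: measurable_eball.
apply/seteqP; split => x; rewrite /eball /=.
  by move=> ->; rewrite subrr enorm0.
move=> xy; apply/eqP; rewrite -subr_eq0; apply/eqP/enorm_eq0/le_anti.
by rewrite xy enorm_ge0.
Qed.

(** The two kernels differ on the diagonal only, where m x m vanishes. *)
Lemma energyE (m : probability (Rd R d) R) : below rho m ->
  energy W K m = (\int[m]_x (W x)%:E - interaction k m)%E.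
Proof.
move=> bm; rewrite /energy; congr (_ - _)%E.
apply: eq_integral => y _.
have m1 := measurable_set1_Rd y.
have mky : measurable_fun [set: Rd R d] (fun x : Rd R d => k ((x : 'rV[R]_d) - y)).
  exact: (measurableT_comp (measurable_radial hK) (@measurable_addr R d (- (y : 'rV[R]_d)))).
have KE (x : Rd R d) : K (enorm ((x : 'rV[R]_d) - y)) =
    k ((x : 'rV[R]_d) - (y : 'rV[R]_d)) + K 0 * \1_[set y : Rd R d] x.
  rewrite indicE; case: (boolP (x \in _)); rewrite ?inE ?notin_setE /=.
    by move=> ->; rewrite subrr /radial /kernel_on_pos enorm0 ltxx mulr1 add0r.
  move=> xy; rewrite mulr0 addr0 /radial /kernel_on_pos.
  case: ifPn => //; rewrite -leNgt => h; exfalso; apply: xy.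
  apply/eqP; rewrite -subr_eq0; apply/eqP/enorm_eq0/le_anti.
  by rewrite h enorm_ge0.
apply: ae_eq_integral => //.
- apply/measurable_EFinP; under eq_fun do rewrite KE.
  by apply: measurable_funD => //; apply: measurable_funM.
- exact/measurable_EFinP.
exists [set y : Rd R d]; split => //.
  apply/eqP; rewrite eq_le measure_ge0 andbT (le_trans (bm _ m1))//.
  by rewrite lebesgue_Rd_set1// mule0.
move=> x /= nx; apply: contrapT => xy; apply: nx => _.
by rewrite KE indicE memNset// mulr0 addr0.
Qed.

(** W is comparable with |x|^2 up to additive constants, and m is finite. *)
Lemma P2_integral_W (m : probability (Rd R d) R) :
  P2 m <-> (\int[m]_x (W x)%:E < +oo)%E.
Proof.
case: hW => _ W0 [C C0 WC] _.
have mn : measurable_fun [set: Rd R d] (fun x : Rd R d => (enorm (x : 'rV[R]_d) ^+ 2)).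
  by apply: measurable_funX; exact: measurable_enorm.
(* one constant c serves as factor and, squared, as additive term *)
have main (f h : Rd R d -> R) (c : R) : 0 < c -> measurable_fun setT f -> measurable_fun setT h ->
    (forall x, 0 <= f x) -> (forall x, 0 <= h x) ->
    (forall x, f x <= c * h x + c * c) ->
    (\int[m]_x (h x)%:E < +oo -> \int[m]_x (f x)%:E < +oo)%E.
  move=> c0 mf mh f0 h0 fh hoo.
  apply: (@le_lt_trans _ _ (\int[m]_x (c%:E * (h x)%:E + (cst (c * c)%:E x)))%E).
    apply: ge0_le_integral => //.
    - by move=> x _; rewrite lee_fin.
    - exact/measurable_EFinP.
    - apply: emeasurable_funD => //; apply: emeasurable_funM => //.
      exact/measurable_EFinP.
    - by move=> x _; rewrite /= -EFinM -EFinD lee_fin.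
  rewrite ge0_integralD//; last 3 first.
  - by move=> x _; rewrite -EFinM lee_fin mulr_ge0// ltW.
  - apply: emeasurable_funM => //; exact/measurable_EFinP.
  - by move=> x _; rewrite lee_fin mulr_ge0// ltW.
  rewrite integral_cst//= probability_setT mule1 ge0_integralZl//; last 3 first.
  - exact/measurable_EFinP.
  - by move=> x _; rewrite lee_fin.
  - by rewrite lee_fin ltW.
  rewrite lte_add_pinfty ?ltry//; apply: lte_mul_pinfty => //.
  by rewrite lee_fin ltW.
split; rewrite /P2 /=.
  apply: (main _ _ (C + 1)) => //; [lra|exact: measurable_W|by move=> x; exact: sqr_ge0|].
  move=> x; have /andP[_ h] := WC x; apply: (le_trans h).
  have := sqr_ge0 (enorm (x : 'rV[R]_d)); nra.
apply: (main _ _ (C + 1)) => //; [lra|exact: measurable_W|by move=> x; exact: sqr_ge0|].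
move=> x; have /andP[h _] := WC x.
have : enorm (x : 'rV[R]_d) ^+ 2 <= C * (W x + C).
  by rewrite -ler_pdivrMl// -lerBlDr.
by have := W0 x; nra.
Qed.

End EnergyOfMeasures.

(** * Existence of a minimizer *)

Section Existence.
Context (R : realType) (d : nat) (rho : R) (W : 'rV[R]_d -> R) (K : R -> R).
Hypotheses (hd : (0 < d)%N) (hrho : 0 < rho) (hW : condW W) (hK : condK d K).
Local Notation L := (lebesgue_Rd R d).
Local Notation k := (@radial R d K).

Lemma radial_ge0 z : 0 <= k z.
Proof. exact: kernel_ge0 hK _. Qed.

Lemma K1_ge0 : 0 <= K 1.
Proof. by case: hK => h _ _ _ _; exact: h. Qed.

Lemma radial_far (z : Rd R d) : 1 < enorm (z : 'rV[R]_d) -> k z <= K 1.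
Proof.
by move=> z1; have := kernel_le hK ltr01 (ltW z1); rewrite {2}/kernel_on_pos ltr01.
Qed.

Lemma radial_interaction_bounded : exists2 c : R, 0 <= c &
  forall m : probability (Rd R d) R, below rho m -> (0 <= interaction k m <= c%:E)%E.
Proof.
have [c hc] := interaction_bounded (measurable_radial hK) radial_ge0
  (radial_integrable_ball hd hK) K1_ge0 radial_far hrho.
exists (Num.max c 0) => [|m bm]; first by rewrite le_max lexx orbT.
have /andP[-> h] := hc m bm; rewrite (le_trans h)// lee_fin le_max lexx//.
Qed.

Lemma interaction_fin_num (m : probability (Rd R d) R) :
  below rho m -> interaction k m \is a fin_num.
Proof.
move=> bm; have [c _ /(_ m bm)/andP[h0 h1]] := radial_interaction_bounded.
by rewrite ge0_fin_numE// (le_lt_trans h1)// ltry.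
Qed.

Lemma integral_W_ge0 (m : probability (Rd R d) R) : (0 <= \int[m]_x (W x)%:E)%E.
Proof. by apply: integral_ge0 => x _; rewrite lee_fin (W_ge0 hW). Qed.

Lemma integral_W_fin_num (m : probability (Rd R d) R) :
  P2 m -> (\int[m]_x (W x)%:E)%E \is a fin_num.
Proof.
by move=> /(P2_integral_W hW); rewrite ge0_fin_numE// integral_W_ge0.
Qed.

(** The density rho on a box with sides 1/rho, 1, ..., 1. *)
Lemma P2r_nonempty : exists m : probability (Rd R d) R, P2r rho m.
Proof.
pose I (i : 'I_d) : set R :=
  if i == Ordinal hd then `[0, rho^-1]%classic else `[0, 1]%classic.
pose Q : set (Rd R d) := [set v | forall i, I i ((v : 'rV[R]_d) 0 i)].
have mI i : measurable (I i) by rewrite /I; case: ifPn.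
have mQ : measurable Q by exact: measurable_product_set.
have rhoV0 : 0 < rho^-1 by rewrite invr_gt0.
have LI i : lebesgue_measure (I i) = (if i == Ordinal hd then rho^-1 else 1)%:E.
  rewrite /I; case: ifPn => _; rewrite lebesgue_measure_itv/= lte_fin.
    by rewrite rhoV0 -EFinB subr0.
  by rewrite ltr01 -EFinB subr0.
have LQ : L Q = rho^-1%:E.
  rewrite /Q (lebesgue_Rd_prod mI) (eq_bigr _ (fun i _ => LI i)) prodEFin.
  congr EFin; rewrite (bigD1 (Ordinal hd) isT) eqxx big1.
    exact: mulr1.
  by move=> i /andP[_ /negbTE ->].
pose mu := mscale (NngNum (ltW hrho)) (mrestr L mQ).
have mu1 : mu setT = 1%E.
  rewrite /mu/= /mscale/= /mrestr/= setTI LQ -EFinM divff// gt_eqF//.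
have [m mE] := exists_probability mu1.
have bm : below rho m.
  move=> A mA; rewrite mE /mu/= /mscale/= /mrestr/=.
  apply: lee_wpmul2l; first by rewrite lee_fin ltW.
  by apply: le_measure; rewrite ?inE//; exact: measurableI.
exists m; apply: below_P2r => //; rewrite /P2 /=.
pose c := d%:R * Num.max rho^-1 1.
have Qc v : Q v -> enorm (v : 'rV[R]_d) <= c.
  move=> Qv; apply: enorm_le_coord => [|i]; first by rewrite le_max ler01 orbT.
  have := Qv i; rewrite /I; case: ifPn => _; rewrite /= in_itv/= => /andP[v0 v1].
    by rewrite ger0_norm// le_max v1.
  by rewrite ger0_norm// le_max v1 orbT.
have mn : measurable_fun [set: Rd R d] (fun x : Rd R d => (enorm (x : 'rV[R]_d) ^+ 2)%:E).
  by apply/measurable_EFinP/measurable_funX; exact: measurable_enorm.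
have mQc : measurable (~` Q) by exact: measurableC.
have mQc0 : m (~` Q) = 0%E.
  by rewrite mE /mu/= /mscale/= /mrestr/= setICl measure0 mule0.
have -> : (\int[m]_x (enorm (x : 'rV[R]_d) ^+ 2)%:E =
           \int[m]_(x in Q) (enorm (x : 'rV[R]_d) ^+ 2)%:E)%E.
  rewrite -(setUv Q) ge0_integral_setU//.
  - rewrite [X in (_ + X)%E]null_set_integral ?adde0//.
    exact: measurable_funTS.
  - exact: measurable_funTS.
  - by move=> x _; rewrite lee_fin sqr_ge0.
  - by rewrite disj_set2E setICr.
apply: (@le_lt_trans _ _ (\int[m]_(x in Q) cst (c ^+ 2)%:E x)%E).
  apply: ge0_le_integral => //.
  - by move=> x _; rewrite lee_fin sqr_ge0.
  - exact: measurable_funTS.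
  - move=> x Qx; rewrite lee_fin ler_pXn2r ?nnegrE ?enorm_ge0 ?Qc//.
    exact: le_trans (enorm_ge0 _) (Qc _ Qx).
rewrite integral_cst//; apply: lte_mul_pinfty; rewrite ?lee_fin ?sqr_ge0//.
by rewrite (le_lt_trans (probability_le1 m mQ))// ltry.
Qed.

(** W grows quadratically, so its integral controls the mass outside large balls
    (Markov); inside a ball all measures lie below rho L, which is finite there. *)
Lemma bounded_W_tight (nu : nat -> probability (Rd R d) R) (w : R) :
  (forall n, below rho (nu n)) ->
  (forall n, \int[nu n]_x (W x)%:E <= w%:E)%E -> uniformly_tight nu.
Proof.
move=> bnu nuw e e0.
have [_ W0 [C C0 WC] _] := hW.
have w0 : 0 <= w by rewrite -lee_fin (le_trans (integral_W_ge0 (nu 0%N)))// nuw.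
(* outside the ball of radius r, W is at least l, so the mass is at most w / l *)
pose l := w / e + 1.
have l0 : 0 < l by rewrite ltr_pwDr// divr_ge0// ltW.
pose r := C * (l + C) + 1.
have r1 : 1 <= r by rewrite lerDr mulr_ge0 ?ltW// addr_gt0.
pose B : set (Rd R d) := eball 0 r.
have mB : measurable B by exact: measurable_eball.
have LB : (L B < +oo)%E by exact: lebesgue_eball_lty.
exists B, (mscale (NngNum (ltW hrho)) (mfrestr mB LB)); split => //.
  move=> n; have mBc : measurable (~` B) by exact: measurableC.
  have h : (l%:E * nu n (~` B) <= w%:E)%E.
    apply: le_trans (nuw n); rewrite -integral_cst//.
    apply: (@le_trans _ _ (\int[nu n]_(x in ~` B) (W x)%:E)%E).
      apply: ge0_le_integral => //.
      - by move=> x _; rewrite lee_fin ltW.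
      - by apply: measurable_funTS; apply/measurable_EFinP; exact: measurable_W hW.
      - move=> x /= /negP; rewrite /B /eball /= subr0 -ltNge => xr.
        rewrite lee_fin; have /andP[h _] := WC x; apply: le_trans h.
        rewrite lerBrDr ler_pdivlMl//.
        apply: (@le_trans _ _ r); first by rewrite /r lerDl.
        rewrite (le_trans (ltW xr))// expr2 ler_peMr ?enorm_ge0//.
        by rewrite (le_trans r1)// ltW.
    apply: ge0_subset_integral => //.
      by apply/measurable_EFinP; exact: measurable_W hW.
    by move=> x _; rewrite lee_fin.
  have nfin : nu n (~` B) \is a fin_num by exact: (fin_num_measure (nu n)).
  move: h; rewrite -(fineK nfin) -EFinM !lee_fin => h.
  have h2 : l * fine (nu n (~` B)) <= l * e.
    apply: (le_trans h); rewrite /l mulrDl divfK ?gt_eqF// mul1r lerDl; exact: ltW.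
  by move: h2; rewrite ler_pM2l.
move=> n A mA /=; rewrite /mscale/= /mfrestr/= /mrestr.
by apply: (bnu n); exact: measurableI.
Qed.

End Existence.

Section Minimizer.
Context (R : realType) (d : nat) (rho : R) (W : 'rV[R]_d -> R) (K : R -> R).
Hypotheses (hd : (0 < d)%N) (hrho : 0 < rho) (hW : condW W) (hK : condK d K).
Local Notation L := (lebesgue_Rd R d).
Local Notation k := (@radial R d K).

Let Wcut (j : nat) (x : Rd R d) : R := Num.min (W x) j%:R.

Let Wcut_bounds j x : 0 <= Wcut j x <= j%:R.
Proof. by rewrite /Wcut le_min (W_ge0 hW) ler0n/= ge_min lexx orbT. Qed.

Let measurable_Wcut j : measurable_fun [set: Rd R d] (Wcut j).
Proof. by apply: measurable_minr => //; exact: measurable_W hW. Qed.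

Let integral_Wcut_le (m : probability (Rd R d) R) j :
  (\int[m]_x (Wcut j x)%:E <= \int[m]_x (W x)%:E)%E.
Proof.
apply: ge0_le_integral => //.
- by move=> x _; rewrite lee_fin; have /andP[] := Wcut_bounds j x.
- exact/measurable_EFinP.
- by apply/measurable_EFinP; exact: measurable_W hW.
- by move=> x _; rewrite lee_fin ge_min lexx.
Qed.

Let integral_W_le (m : probability (Rd R d) R) (c : R) :
  (forall j, \int[m]_x (Wcut j x)%:E <= c%:E)%E -> (\int[m]_x (W x)%:E <= c%:E)%E.
Proof.
move=> h.
have nd (x : Rd R d) : {homo (fun j => (Wcut j x)%:E) : i j / (i <= j)%N >-> (i <= j)%E}.
  move=> i j ij; rewrite lee_fin /Wcut le_min ge_min lexx/=.
  by rewrite ge_min ler_nat ij orbT.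
have cv (x : Rd R d) : (Wcut j x)%:E @[j --> \oo] --> (W x)%:E.
  apply: cvg_near_cst; exists (Num.truncn (W x)).+1 => // n /= zn.
  rewrite /Wcut min_l//.
  by rewrite (le_trans (ltW (truncnS_gt _)))// ler_nat.
have mm j : measurable_fun [set: Rd R d] (fun x => (Wcut j x)%:E) by exact/measurable_EFinP.
have -> : (\int[m]_x (W x)%:E = limn (fun j => \int[m]_x (Wcut j x)%:E))%E.
  rewrite -monotone_convergence//.
  - by apply: eq_integral => x _; apply/esym/cvg_lim => //; exact: cv.
  - by move=> j x _; rewrite lee_fin; have /andP[] := Wcut_bounds j x.
apply: lime_le; last by exact: nearW.
apply: ereal_nondecreasing_is_cvgn => i j ij; apply: ge0_le_integral => //.
- by move=> x _; rewrite lee_fin; have /andP[] := Wcut_bounds i x.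
- by move=> x _; exact: nd.
Qed.

Let I (m : probability (Rd R d) R) := fine (interaction k m).
Let w (m : probability (Rd R d) R) := fine (\int[m]_x (W x)%:E)%E.

Let energy_real (m : probability (Rd R d) R) : P2r rho m ->
  energy W K m = (w m - I m)%:E.
Proof.
move=> Pm; have bm := P2r_below hrho Pm; rewrite (energyE W hd hK bm).
have [P2m _] := Pm.
by rewrite EFinB !fineK ?(interaction_fin_num hd hrho hK)// (integral_W_fin_num hW).
Qed.

(** The integrals of the truncations of W and of k converge along the ultrafilter.
    Removing first the truncation of k, then that of W, gives at the limit that the
    integral of W is at most the infimum plus the interaction energy. *)
Lemma exists_minimizer : exists m, is_minimizer rho W K m.
Proof.
have [c c0 Ic] := radial_interaction_bounded hd hrho hK.
have Ibd (m : probability (Rd R d) R) : below rho m -> 0 <= I m <= c.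
  move=> bm; have := Ic m bm; rewrite /I.
  by rewrite -[interaction k m]fineK ?(interaction_fin_num hd hrho hK)// !lee_fin.
have w0 (m : probability (Rd R d) R) : 0 <= w m by rewrite fine_ge0// (integral_W_ge0 hW).
pose E : set R := [set w m - I m | m in [set m | P2r rho m]].
have Einf : has_inf E.
  split; first by have [m Pm] := P2r_nonempty hd hrho; exists (w m - I m); exists m.
  exists (- c) => _ [m Pm <-]; have /andP[_ h] := Ibd m (P2r_below hrho Pm).
  have := w0 m; lra.
pose e := inf E.
have eE m : P2r rho m -> e <= w m - I m.
  by move=> Pm; apply: ge_inf; [case: Einf|exists m].
have /choice[nu nuP] : forall n : nat, exists m, P2r rho m /\ w m - I m < e + n.+1%:R^-1.
  move=> n; have n0 : 0 < n.+1%:R^-1 :> R by rewrite invr_gt0.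
  have [_ [m Pm <-] h] := inf_adherent n0 Einf.
  by exists m.
have Pnu n : P2r rho (nu n) by have [] := nuP n.
have bnu n : below rho (nu n) by exact: (P2r_below hrho).
have wfin n : (\int[nu n]_x (W x)%:E = (w (nu n))%:E)%E.
  by rewrite fineK// (integral_W_fin_num hW)//; have [] := Pnu n.
have wnu n : w (nu n) <= e + n.+1%:R^-1 + I (nu n).
  by have [_ /ltW] := nuP n; rewrite lerBlDr.
have wbd n : (\int[nu n]_x (W x)%:E <= (e + 1 + c)%:E)%E.
  rewrite wfin lee_fin; apply: (le_trans (wnu n)).
  have /andP[_ h] := Ibd _ (bnu n).
  have : n.+1%:R^-1 <= 1 :> R by rewrite invf_le1// ler1n.
  by move=> ?; apply: lerD => //; exact: lerD.
have ut := bounded_W_tight hrho hW bnu wbd.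
(* the limit along a free ultrafilter replaces the extraction of subsequences *)
have [U [FU oU]] := @ultraFilterLemma _ (\oo : set_system nat) _.
have [m mP] := @ultralimit_probability R U FU _ _ nu (tight_nearly_dominated ut).
have bm : below rho m.
  move=> A mA; have [LA|LA] := ltP (L A) +oo%E; last first.
    by move: LA; rewrite leye_eq => /eqP ->; rewrite gt0_muley ?lte_fin// leey.
  have LAfin : L A \is a fin_num by rewrite ge0_fin_numE.
  have mAfin (m' : probability (Rd R d) R) : m' A \is a fin_num.
    exact: fin_num_measure.
  rewrite -(fineK LAfin) -(fineK (mAfin m)) -EFinM lee_fin.
  apply: (ler_cvg_to (mP A mA) (cvg_cst (rho * fine (L A)))).
  apply: nearW => n; rewrite -lee_fin EFinM (fineK LAfin) (fineK (mAfin (nu n))).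
  exact: bnu.
have IN n : interaction (truncation k (K 1) n) m \is a fin_num /\
   fine (interaction (truncation k (K 1) n) (nu i)) @[i --> U] -->
   fine (interaction (truncation k (K 1) n) m).
  have mk := measurable_radial hK; have k0 := radial_ge0 hK; have K10 := K1_ge0 hK.
  split; first by have [] := interaction_truncation_le mk k0 K10 m n.
  have mt := measurable_truncation (K 1) mk n.
  have tb z := truncation_bounds k0 K10 n z.
  have t0 z : 0 <= truncation k (K 1) n z by have /andP[] := tb z.
  rewrite (interactionE m mt t0).
  under eq_fun do rewrite (interactionE _ mt t0).
  apply: (@cvg_integral_bounded R U FU _ _ (fun i => (nu i \x nu i)%E) (m \x m)%E
    (@cvg_product R _ _ U FU nu m ut mP) _ (K 1 + n%:R)).
    exact: (measurableT_comp mt (@measurable_sub R d)).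
  by move=> p; exact: tb.
pose t n := fine (\int[L]_z (tail k (K 1) n z)%:E)%E.
have tfin n : (\int[L]_z (tail k (K 1) n z)%:E = (t n)%:E)%E.
  rewrite fineK// ge0_fin_numE.
    exact: (integral_tail_lty (measurable_radial hK) (radial_ge0 hK)
      (radial_integrable_ball hd hK) (K1_ge0 hK) (radial_far hK)).
  by apply: integral_ge0 => z _; rewrite lee_fin tail_ge0.
have t_cvg : t n @[n --> \oo] --> 0.
  have := integral_tail_cvg0 (measurable_radial hK) (radial_ge0 hK)
      (radial_integrable_ball hd hK) (K1_ge0 hK) (radial_far hK).
  by move/fine_cvg.
have trunc_le (m' : probability (Rd R d) R) n : below rho m' ->
    I m' <= fine (interaction (truncation k (K 1) n) m') + rho * t n.
  move=> bm'.
  have := interaction_truncation (measurable_radial hK) (radial_ge0 hK) (K1_ge0 hK)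
    hrho n bm'.
  rewrite tfin -EFinM -[interaction k m']fineK ?(interaction_fin_num hd hrho hK)//.
  have [h _] := interaction_truncation_le (measurable_radial hK) (radial_ge0 hK)
    (K1_ge0 hK) m' n.
  by rewrite -[interaction (truncation _ _ _) _]fineK// -EFinD lee_fin.
have IN_le n : fine (interaction (truncation k (K 1) n) m) <= I m.
  have [h _] := IN n.
  rewrite -lee_fin (fineK h) (fineK (interaction_fin_num hd hrho hK bm)).
  rewrite (interactionE m (measurable_radial hK) (radial_ge0 hK)).
  have mt := measurable_truncation (K 1) (measurable_radial hK) n.
  have tb z := truncation_bounds (radial_ge0 hK) (K1_ge0 hK) n z.
  have t0 z : 0 <= truncation k (K 1) n z by have /andP[] := tb z.
  rewrite (interactionE m mt t0); apply: ge0_le_integral => //.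
  - by move=> p _; rewrite lee_fin.
  - exact: measurable_pair_kernel.
  - by apply: measurable_pair_kernel; exact: measurable_radial.
  - by move=> p _; rewrite lee_fin /truncation ge_min lexx.
have main j n : fine (\int[m]_x (Wcut j x)%:E)%E <= e + I m + rho * t n.
  have Wc := @cvg_integral_bounded R U FU _ _ nu m mP (Wcut j) j%:R
    (measurable_Wcut j) (Wcut_bounds j).
  have [_ INc] := IN n.
  have rhs : e + i.+1%:R^-1 + fine (interaction (truncation k (K 1) n) (nu i)) + rho * t n
      @[i --> U] --> e + 0 + fine (interaction (truncation k (K 1) n) m) + rho * t n.
    apply: cvgD; last exact: cvg_cst.
    apply: cvgD; last exact: INc.
    apply: cvgD; first exact: cvg_cst.
    apply: (cvg_trans _ (@cvg_harmonic R)).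
    by move=> A hA; apply: oU.
  have le_lim : fine (\int[m]_x (Wcut j x)%:E)%E <=
      e + 0 + fine (interaction (truncation k (K 1) n) m) + rho * t n.
    apply: (ler_cvg_to Wc rhs); apply: nearW => i.
    have h1 : fine (\int[nu i]_x (Wcut j x)%:E)%E <= w (nu i).
      have [f1 _] := prob_integral_bounded (nu i) (measurable_Wcut j) (Wcut_bounds j).
      by rewrite -lee_fin fineK// -wfin; exact: integral_Wcut_le.
    have := wnu i; have := trunc_le _ n (bnu i); move: (i.+1%:R^-1) => q; lra.
  by apply: (le_trans le_lim); have := IN_le n; lra.
have main2 j : fine (\int[m]_x (Wcut j x)%:E)%E <= e + I m.
  have lim1 : e + I m + rho * t n @[n --> \oo] --> e + I m + rho * 0.
    apply: cvgD; first exact: cvg_cst.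
    by apply: cvgM => //; exact: cvg_cst.
  move: lim1; rewrite mulr0 addr0 => lim1.
  by apply: (ler_cvg_to (cvg_cst _) lim1); apply: nearW => n; exact: main.
have Wm : (\int[m]_x (W x)%:E <= (e + I m)%:E)%E.
  apply: integral_W_le => j.
  have [f1 _] := prob_integral_bounded m (measurable_Wcut j) (Wcut_bounds j).
  by rewrite -(fineK f1) lee_fin.
have Pm : P2r rho m.
  apply: below_P2r => //; apply/(P2_integral_W hW).
  by rewrite (le_lt_trans Wm)// ltry.
exists m; split => // m' Pm'.
rewrite !energy_real// lee_fin; apply: le_trans (eE _ Pm').
have : w m <= e + I m.
  by rewrite -lee_fin fineK// (integral_W_fin_num hW)//; case: Pm.
lra.
Qed.

End Minimizer.

(** * The energy as a quadratic form in the density *)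

Section BilinearEnergy.
Context (R : realType) (d : nat) (k : Rd R d -> R).
Local Notation L := (lebesgue_Rd R d).
Hypotheses (mk : measurable_fun [set: Rd R d] k) (k_ge0 : forall z, 0 <= k z).

Definition nonneg_measurable (u : Rd R d -> R) :=
  measurable_fun [set: Rd R d] u /\ forall x, 0 <= u x.
Local Notation nnm := nonneg_measurable.

Definition potential (u : Rd R d -> R) (y : Rd R d) : \bar R :=
  (\int[L]_x ((k ((x : 'rV[R]_d) - (y : 'rV[R]_d) : Rd R d))%:E * (u x)%:E))%E.

Definition mutual (u v : Rd R d -> R) : \bar R :=
  (\int[L]_y (potential u y * (v y)%:E))%E.

Lemma potential_ge0 u y : nnm u -> (0 <= potential u y)%E.
Proof. by move=> [_ u0]; apply: integral_ge0 => x _; rewrite mule_ge0// lee_fin. Qed.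

Lemma measurable_shifted_kernel y : measurable_fun [set: Rd R d]
  (fun x : Rd R d => (k ((x : 'rV[R]_d) - (y : 'rV[R]_d) : Rd R d))%:E).
Proof.
apply/measurable_EFinP.
exact: (measurableT_comp mk (@measurable_addr R d (- (y : 'rV[R]_d)))).
Qed.

Lemma measurable_potential_L u : nnm u -> measurable_fun [set: Rd R d] (potential u).
Proof.
move=> [mu u0].
apply: (@measurable_fun_fubini_tonelli_G _ _ _ _ _ L
  (fun p => (k (difference p))%:E * (u p.1)%:E)%E) => //.
  apply: emeasurable_funM; first exact: measurable_pair_kernel.
  by apply/measurable_EFinP; exact: (measurableT_comp mu measurable_fst).
by move=> p; rewrite mule_ge0// lee_fin.
Qed.

Lemma mutual_ge0 u v : nnm u -> nnm v -> (0 <= mutual u v)%E.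
Proof.
move=> nu [_ v0]; apply: integral_ge0 => y _; rewrite mule_ge0 ?lee_fin//.
exact: potential_ge0.
Qed.

Lemma nnmD u v : nnm u -> nnm v -> nnm (u \+ v).
Proof.
move=> [mu u0] [mv v0]; split; first exact: measurable_funD.
by move=> x /=; rewrite addr_ge0.
Qed.

Lemma potentialD u v y : nnm u -> nnm v ->
  potential (u \+ v) y = (potential u y + potential v y)%E.
Proof.
move=> [mu u0] [mv v0]; rewrite /potential -ge0_integralD//.
- by apply: eq_integral => x _; rewrite /= EFinD ge0_muleDr ?lee_fin.
- by move=> x _; rewrite mule_ge0// lee_fin.
- by apply: emeasurable_funM; [exact: measurable_shifted_kernel|exact/measurable_EFinP].
- by move=> x _; rewrite mule_ge0// lee_fin.
- by apply: emeasurable_funM; [exact: measurable_shifted_kernel|exact/measurable_EFinP].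
Qed.

Let measurable_mutual u v : nnm u -> nnm v ->
  measurable_fun [set: Rd R d] (fun y => potential u y * (v y)%:E)%E.
Proof.
move=> nu [mv _]; apply: emeasurable_funM; last exact/measurable_EFinP.
exact: measurable_potential_L.
Qed.

Let mutual_pt_ge0 u v y : nnm u -> nnm v -> (0 <= potential u y * (v y)%:E)%E.
Proof. by move=> nu [_ v0]; rewrite mule_ge0 ?lee_fin//; exact: potential_ge0. Qed.

Lemma mutualDl u v t : nnm u -> nnm v -> nnm t ->
  mutual (u \+ v) t = (mutual u t + mutual v t)%E.
Proof.
move=> nu nv nt; rewrite /mutual.
rewrite -(ge0_integralD L measurableT (fun y _ => mutual_pt_ge0 y nu nt)
  (measurable_mutual nu nt) (fun y _ => mutual_pt_ge0 y nv nt) (measurable_mutual nv nt)).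
by apply: eq_integral => y _; rewrite potentialD// ge0_muleDl//; exact: potential_ge0.
Qed.

Lemma mutualDr u v t : nnm u -> nnm v -> nnm t ->
  mutual t (u \+ v) = (mutual t u + mutual t v)%E.
Proof.
move=> nu nv nt; rewrite /mutual.
rewrite -(ge0_integralD L measurableT (fun y _ => mutual_pt_ge0 y nt nu)
  (measurable_mutual nt nu) (fun y _ => mutual_pt_ge0 y nt nv) (measurable_mutual nt nv)).
apply: eq_integral => y _ /=; rewrite EFinD ge0_muleDr ?lee_fin//.
  by case: nu.
by case: nv.
Qed.

Lemma le_mutual u u' v v' : nnm u -> nnm u' -> nnm v -> nnm v' ->
  (forall x, u x <= u' x) -> (forall x, v x <= v' x) ->
  (mutual u v <= mutual u' v')%E.
Proof.
move=> nu nu' nv nv' uu' vv'; apply: ge0_le_integral => //.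
- by move=> y _; exact: mutual_pt_ge0.
- exact: measurable_mutual.
- exact: measurable_mutual.
move=> y _; apply: lee_pmul; rewrite ?lee_fin//; try exact: potential_ge0.
  by case: nv.
case: nu nu' => mu u0 [mu' u0']; apply: ge0_le_integral => //.
- by move=> x _; rewrite mule_ge0// lee_fin.
- by apply: emeasurable_funM; [exact: measurable_shifted_kernel|exact/measurable_EFinP].
- by apply: emeasurable_funM; [exact: measurable_shifted_kernel|exact/measurable_EFinP].
- by move=> x _; rewrite lee_wpmul2l// lee_fin.
Qed.

(** The second difference of the quadratic form u |-> mutual u u along u - v.  It is
    stated for the perturbations f + 2u and f + 2v of f + u + v, with all three
    functions nonnegative, so that only sums of nonnegative quantities occur. *)
Lemma mutual_second_difference f u v : nnm f -> nnm u -> nnm v ->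
  (mutual (f \+ (u \+ v))%R (f \+ (u \+ v))%R < +oo)%E ->
  exists J Ju Jv juu juv jvu jvv : R,
  [/\ mutual (f \+ (u \+ v))%R (f \+ (u \+ v))%R = J%:E,
      mutual (f \+ (u \+ u))%R (f \+ (u \+ u))%R = Ju%:E,
      mutual (f \+ (v \+ v))%R (f \+ (v \+ v))%R = Jv%:E,
      [/\ mutual u u = juu%:E, mutual u v = juv%:E,
          mutual v u = jvu%:E & mutual v v = jvv%:E] &
      Ju + Jv = 2 * J + 2 * (juu + jvv - juv - jvu)].
Proof.
move=> nf nu nv Joo.
have nuv := nnmD nu nv; have nuu := nnmD nu nu; have nvv := nnmD nv nv.
have ng := nnmD nf nuv; have nfu := nnmD nf nuu; have nfv := nnmD nf nvv.
have fin p q : nnm p -> nnm q -> (forall x, p x <= f x + (u x + v x)) ->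
    (forall x, q x <= f x + (u x + v x)) -> exists c, mutual p q = c%:E.
  move=> np nq pg qg; exists (fine (mutual p q)); rewrite fineK//.
  rewrite ge0_fin_numE ?mutual_ge0//.
  by apply: le_lt_trans Joo; exact: le_mutual.
have [[_ f0] [_ u0] [_ v0]] := And3 nf nu nv.
have lf x : f x <= f x + (u x + v x) by rewrite lerDl addr_ge0.
have lu x : u x <= f x + (u x + v x) by rewrite addrCA lerDl addr_ge0.
have lv x : v x <= f x + (u x + v x) by rewrite addrC -addrA addrCA lerDl addr_ge0.
have [jff Jff] := fin _ _ nf nf lf lf; have [jfu Jfu] := fin _ _ nf nu lf lu.
have [jfv Jfv] := fin _ _ nf nv lf lv; have [juf Juf] := fin _ _ nu nf lu lf.
have [juu Juu] := fin _ _ nu nu lu lu; have [juv Juv] := fin _ _ nu nv lu lv.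
have [jvf Jvf] := fin _ _ nv nf lv lf; have [jvu Jvu] := fin _ _ nv nu lv lu.
have [jvv Jvv] := fin _ _ nv nv lv lv.
exists (jff + (jfu + jfv) + (juf + (juu + juv) + (jvf + (jvu + jvv)))).
exists (jff + (jfu + jfu) + (juf + (juu + juu) + (juf + (juu + juu)))).
exists (jff + (jfv + jfv) + (jvf + (jvv + jvv) + (jvf + (jvv + jvv)))).
exists juu, juv, jvu, jvv; split => //.
- by rewrite !mutualDl// !mutualDr// Jff Jfu Jfv Juf Juu Juv Jvf Jvu Jvv.
- by rewrite !mutualDl// !mutualDr// Jff Jfu Juf Juu.
- by rewrite !mutualDl// !mutualDr// Jff Jfv Jvf Jvv.
- ring.
Qed.

Lemma interaction_mutual (m : probability (Rd R d) R) u : nnm u ->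
  (forall A, measurable A -> m A = (\int[L]_(x in A) (u x)%:E)%E) ->
  interaction k m = mutual u u.
Proof.
move=> nu mE; have [mu u0] := nu; rewrite /interaction.
have potE y : (\int[m]_x (k ((x : 'rV[R]_d) - (y : 'rV[R]_d) : Rd R d)%R)%:E)%E = potential u y.
  rewrite (integral_density mu u0 mE (measurable_shifted_kernel y))//.
  by move=> x; rewrite lee_fin.
under eq_integral do rewrite potE.
rewrite (integral_density mu u0 mE (measurable_potential_L nu))//.
by move=> y; exact: potential_ge0.
Qed.

Section Indicators.
Hypothesis hd : (0 < d)%N.

Lemma nnm_indic (s : R) (A : set (Rd R d)) : 0 <= s -> measurable A ->
  nnm (fun x => s * \1_A x).
Proof.
move=> s0 mA; split => [|x]; last by rewrite mulr_ge0.
by apply: measurable_funM => //; exact: measurable_indic.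
Qed.

Let integral_cst_indic (c s b : R) (B : set (Rd R d)) : 0 <= c -> 0 <= s ->
  measurable B -> L B = b%:E ->
  (\int[L]_y (c%:E * (s * \1_B y)%:E) = (c * s * b)%:E)%E.
Proof.
move=> c0 s0 mB LB.
have -> : (fun y => c%:E * (s * \1_B y)%:E)%E = (fun y => (c * s)%:E * (\1_B y)%:E)%E.
  by apply/funext => y; rewrite -!EFinM mulrA.
rewrite ge0_integralZl//; last 2 first.
  by apply/measurable_EFinP; exact: measurable_indic.
  by rewrite lee_fin mulr_ge0.
by rewrite integral_indic// setIT LB -EFinM.
Qed.

Let measurable_cst_indic (c s : R) (B : set (Rd R d)) : 0 <= s -> measurable B ->
  measurable_fun [set: Rd R d] (fun y => c%:E * (s * \1_B y)%:E)%E.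
Proof.
move=> s0 mB; apply: emeasurable_funM => //; apply/measurable_EFinP.
by have [] := nnm_indic s0 mB.
Qed.

Let measurable_pot_integrand u y : nnm u -> measurable_fun [set: Rd R d]
  (fun x : Rd R d => ((k ((x : 'rV[R]_d) - (y : 'rV[R]_d) : Rd R d)%R)%:E * (u x)%:E)%E).
Proof.
move=> [mu _]; apply: emeasurable_funM; last exact/measurable_EFinP.
exact: measurable_shifted_kernel.
Qed.

Let potential_indic_le (s c a : R) (A : set (Rd R d)) (y : Rd R d) :
  measurable A -> L A = a%:E -> 0 <= s -> 0 <= c ->
  (forall x : Rd R d, A x -> k ((x : 'rV[R]_d) - (y : 'rV[R]_d)) <= c) ->
  (potential (fun x => s * \1_A x)%R y <= (c * s * a)%:E)%E.
Proof.
move=> mA LA s0 c0 kc; have [mi i0] := nnm_indic s0 mA.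
rewrite -(integral_cst_indic c0 s0 mA LA); apply: ge0_le_integral => //.
- by move=> x _; rewrite mule_ge0// lee_fin.
- by apply: measurable_pot_integrand.
- exact: measurable_cst_indic.
move=> x _; rewrite indicE; case: (boolP (x \in A)) => [/set_mem Ax|_].
  by rewrite -!EFinM lee_fin ler_wpM2r ?mulr_ge0// kc.
by rewrite mulr0 !mule0.
Qed.

(** The lower bound on k fails at x = y, which is negligible. *)
Let potential_indic_ge (s c a : R) (A : set (Rd R d)) (y : Rd R d) :
  measurable A -> L A = a%:E -> 0 <= s -> 0 <= c ->
  (forall x : Rd R d, A x -> x <> y -> c <= k ((x : 'rV[R]_d) - (y : 'rV[R]_d))) ->
  ((c * s * a)%:E <= potential (fun x => s * \1_A x)%R y)%E.
Proof.
move=> mA LA s0 c0 kc; have [mi i0] := nnm_indic s0 mA.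
have m1 := measurable_set1_Rd y.
pose A' := A `\` [set y : Rd R d].
have mA' : measurable A' by exact: measurableD.
have LA' : L A' = a%:E.
  have LAoo : (L A < +oo)%E by rewrite LA ltry.
  rewrite -LA measureD//.
  rewrite [X in (_ - X)%E](_ : _ = 0%E) ?sube0//.
  apply: (@subset_measure0 _ _ _ L _ [set y : Rd R d]) => //; first exact: measurableI.
  exact: lebesgue_Rd_set1.
rewrite -(integral_cst_indic c0 s0 mA' LA'); apply: ge0_le_integral => //.
- by move=> x _; rewrite -EFinM lee_fin mulr_ge0// mulr_ge0.
- exact: measurable_cst_indic.
- by apply: measurable_pot_integrand.
move=> x _; rewrite indicE; case: (boolP (x \in A')) => [/set_mem[Ax xy]|_].
  by rewrite indicE mem_set// -!EFinM lee_fin ler_wpM2r ?mulr1// kc.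
by rewrite mulr0 mule0 mule_ge0// lee_fin.
Qed.

Lemma mutual_far_le (s t c a b : R) (A B : set (Rd R d)) :
  measurable A -> measurable B -> L A = a%:E -> L B = b%:E ->
  0 <= s -> 0 <= t -> 0 <= c ->
  (forall x y : Rd R d, A x -> B y -> k ((x : 'rV[R]_d) - (y : 'rV[R]_d)) <= c) ->
  (mutual (fun x => s * \1_A x)%R (fun x => t * \1_B x)%R <= (c * s * a * t * b)%:E)%E.
Proof.
move=> mA mB LA LB s0 t0 c0 kc.
have nA := nnm_indic s0 mA; have nB := nnm_indic t0 mB.
have a0 : 0 <= a by rewrite -lee_fin -LA.
have csa0 : 0 <= c * s * a by rewrite !mulr_ge0.
rewrite -(integral_cst_indic csa0 t0 mB LB); apply: ge0_le_integral => //.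
- by move=> y _; exact: (mutual_pt_ge0 y nA nB).
- exact: (measurable_mutual nA nB).
- exact: measurable_cst_indic.
move=> y _; rewrite indicE; case: (boolP (y \in B)) => [/set_mem By|_].
  rewrite lee_wpmul2r ?lee_fin ?mulr_ge0//.
  by apply: potential_indic_le => // x Ax; exact: kc.
by rewrite mulr0 !mule0.
Qed.

Lemma mutual_near_ge (s c a : R) (A : set (Rd R d)) :
  measurable A -> L A = a%:E -> 0 <= s -> 0 <= c ->
  (forall x y : Rd R d, A x -> A y -> x <> y -> c <= k ((x : 'rV[R]_d) - (y : 'rV[R]_d))) ->
  ((c * s * a * s * a)%:E <= mutual (fun x => s * \1_A x)%R (fun x => s * \1_A x)%R)%E.
Proof.
move=> mA LA s0 c0 kc.
have nA := nnm_indic s0 mA.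
have a0 : 0 <= a by rewrite -lee_fin -LA.
have csa0 : 0 <= c * s * a by rewrite !mulr_ge0.
rewrite -(integral_cst_indic csa0 s0 mA LA); apply: ge0_le_integral => //.
- by move=> x _; rewrite -EFinM lee_fin mulr_ge0// mulr_ge0.
- exact: measurable_cst_indic.
- exact: (measurable_mutual nA nA).
move=> y _; rewrite indicE; case: (boolP (y \in A)) => [/set_mem Ay|_].
  rewrite lee_wpmul2r ?lee_fin ?mulr_ge0//.
  by apply: potential_indic_ge => // x Ax; exact: kc.
by rewrite mulr0 !mule0.
Qed.

End Indicators.
End BilinearEnergy.

(** * Small and distant pieces of a set of positive measure *)

Section Pieces.
Context (R : realType) (d : nat).
Local Notation L := (lebesgue_Rd R d).

(** The boxes of side h with corners in h Z^d. *)
Let corner (h : R) (z : 'rV[int]_d) (i : 'I_d) : R := h * (z 0 i)%:~R.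

Lemma box_cover (h : R) (x : Rd R d) : 0 < h ->
  exists z, box (corner h z) h x.
Proof.
move=> h0; exists (\row_i Num.floor ((x : 'rV[R]_d) 0 i / h)) => i.
rewrite /= in_itv/= /corner mxE.
set y := (x : 'rV[R]_d) 0 i.
have h1 : (Num.floor (y / h))%:~R <= y / h by exact: ge_floor.
have h2 : y / h < (Num.floor (y / h) + 1)%:~R by exact: floorD1_gt.
move: h1; rewrite ler_pdivlMr// mulrC => -> /=.
move: h2; rewrite ltr_pdivrMr// intrD mulrDl mul1r mulrC => h2.
exact: ltW.
Qed.

(** Countably many boxes cover the space. *)
Lemma positive_in_box (S : set (Rd R d)) (h : R) : measurable S ->
  (0 < L S)%E -> 0 < h -> exists z, (0 < L (S `&` box (corner h z) h))%E.
Proof.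
move=> mS LS h0; apply: contrapT => nz.
pose F n : set (Rd R d) := if @unpickle 'rV[int]_d n is Some z then
  S `&` box (corner h z) h else set0.
have LF n : L.-negligible (F n).
  rewrite /F; case: unpickle => [z|]; last exact: negligible_set0.
  exists (S `&` box (corner h z) h); split => //.
    by apply: measurableI => //; exact: measurable_box.
  apply/eqP; rewrite eq_le measure_ge0 andbT leNgt; apply/negP => h1.
  by apply: nz; exists z.
have : L.-negligible S.
  apply: negligibleS (negligible_bigcup LF) => x Sx.
  have [z xz] := box_cover x h0.
  by exists (pickle z) => //; rewrite /F pickleK.
by move=> /negligibleP -/(_ mS) LS0; move: LS; rewrite LS0 ltxx.
Qed.

Lemma small_piece (S : set (Rd R d)) (r : R) : measurable S ->
  (0 < L S)%E -> 0 < r -> exists (A : set (Rd R d)) (a : R),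
  [/\ measurable A, A `<=` S, 0 < a, L A = a%:E &
    forall x y : Rd R d, A x -> A y -> enorm ((x : 'rV[R]_d) - y) <= r].
Proof.
move=> mS LS r0; pose h := r / d.+1%:R.
have h0 : 0 < h by rewrite divr_gt0.
have [z Lz] := positive_in_box mS LS h0.
set A := S `&` box (corner h z) h in Lz.
have mA : measurable A by apply: measurableI => //; exact: measurable_box.
have LAoo : (L A < +oo)%E.
  apply: (@le_lt_trans _ _ (L (box (corner h z) h))).
    apply: le_measure; rewrite ?inE//; first exact: measurable_box.
    exact: subIsetr.
  by rewrite lebesgue_box ?ltry// ltW.
have LAE : L A = (fine (L A))%:E by rewrite fineK// ge0_fin_numE.
exists A, (fine (L A)); split => //; first exact: subIsetl.
  by rewrite -lte_fin -LAE.
move=> x y [_ Ax] [_ Ay].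
apply: (@le_trans _ _ (d%:R * h)).
  apply: enorm_le_coord => [|i]; first exact: ltW.
  have := Ax i; have := Ay i; rewrite /= !in_itv/= !mxE => /andP[? ?] /andP[? ?].
  by rewrite ler_norml; apply/andP; split; lra.
rewrite /h mulrCA -[leRHS]mulr1 ler_wpM2l ?ltW//.
by rewrite ltr_pdivrMr// mul1r ltr_nat.
Qed.

(** Take a box of side t that meets S in positive measure, with t so small that the
    box three times as large, being of measure (3t)^d < L(S), cannot contain almost
    all of S.  Points outside the large box are at distance at least t from the
    small one. *)
Lemma separated_pieces (S : set (Rd R d)) : (0 < d)%N -> measurable S ->
  (0 < L S)%E -> exists (t : R) (A B : set (Rd R d)),
  [/\ 0 < t, measurable A /\ measurable B, A `<=` S /\ B `<=` S,
     (0 < L A)%E /\ (0 < L B)%E &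
    forall x y : Rd R d, A x -> B y -> t <= enorm ((x : 'rV[R]_d) - y)].
Proof.
move=> hd mS LS.
have [t t0 tS] : exists2 t : R, 0 < t & (((3 * t) ^+ d)%:E < L S)%E.
  have [c c0 cS] : exists2 c : R, 0 < c & (c%:E < L S)%E.
    move: LS; case: (L S) => [r| |] //; last by move=> _; exists 1; rewrite ?ltry.
    by rewrite lte_fin => r0; exists (r / 2); rewrite ?lte_fin ?divr_gt0//; lra.
  exists (Num.min c 1 / 3).
    by rewrite divr_gt0// lt_min c0/=.
  apply: le_lt_trans cS; rewrite lee_fin mulrC divfK//.
  rewrite -(prednK hd) exprS -[leRHS]mulr1.
  have m0 : 0 <= Num.min c 1 by rewrite le_min ltW//=.
  apply: ler_pM => //; rewrite ?exprn_ge0 ?ge_min ?lexx//.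
  by apply: exprn_ile1 => //; rewrite ge_min lexx orbT.
have [z Lz] := positive_in_box mS LS t0.
pose Q : set (Rd R d) := box (fun i => corner t z i - t) (3 * t).
have mQ : measurable Q by exact: measurable_box.
have LQ : L Q = ((3 * t) ^+ d)%:E by rewrite lebesgue_box// mulr_ge0// ltW.
have mSQ : measurable (S `\` Q) by exact: measurableD.
have t30 : 0 < 3 * t by rewrite mulr_gt0.
exists t, (S `&` box (corner t z) t), (S `\` Q); split => //.
- by split => //; apply: measurableI => //; exact: measurable_box.
- split => //; rewrite lt0e measure_ge0 andbT; apply/eqP => L0.
  move: tS; rewrite -LQ ltNge => /negP; apply.
  apply: (@le_trans _ _ (L (Q `|` S `\` Q))).
    apply: le_measure; rewrite ?inE//; first exact: measurableU.
    by move=> x Sx; have [Qx|nQx] := pselect (Q x); [left|right].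
  by apply: (le_trans (measureU2 _ _ _)); rewrite //= L0 adde0.
move=> x y [_ Ax] [_ nQy].
have [i] : exists i, ~ `[corner t z i - t, corner t z i - t + 3 * t]%classic ((y : 'rV[R]_d) 0 i).
  by apply/existsNP.
rewrite /= in_itv/= => /negP; rewrite negb_and -!ltNge => yi.
apply: le_trans (coord_le_enorm _ i).
have := Ax i; rewrite /= in_itv/= !mxE => /andP[x1 x2].
case/orP: yi => yi.
  by rewrite ger0_norm; lra.
by rewrite ler0_norm; lra.
Qed.

End Pieces.

(** * Minimizers take only the values 0 and rho *)

(** Exchanging mass between A and B keeps the density between 0 and rho; f is the
    density deprived of both perturbations. *)
Lemma perturbation_bounds (R : realFieldType) (rho del g s1 s2 : R) (inA inB : bool) :
  let p1 := s1 * inA%:R in let p2 := s2 * inB%:R in let f := g - p1 - p2 in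
  0 <= g <= rho -> 0 < s1 <= del -> 0 < s2 <= del -> ~~ (inA && inB) ->
  (inA || inB -> del <= g <= rho - del) ->
  [/\ 0 <= f, f + (p1 + p2) = g, f + (p1 + p1) <= rho & f + (p2 + p2) <= rho].
Proof.
move=> p1 p2 f /andP[? ?] /andP[? ?] /andP[? ?]; rewrite {}/f {}/p1 {}/p2.
case: inA inB => [] [] //= _; try move=> /(_ isT)/andP[? ?]; try move=> _.
- by split; lra.
- by split; lra.
- by split; lra.
Qed.

Section BangBang.
Context (R : realType) (d : nat) (rho : R) (W : 'rV[R]_d -> R) (K : R -> R).
Hypotheses (hd : (0 < d)%N) (hrho : 0 < rho) (hW : condW W) (hK : condK d K).
Local Notation L := (lebesgue_Rd R d).
Local Notation k := (@radial R d K).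
Local Notation nnm := (@nonneg_measurable R d).

Let mk : measurable_fun [set: Rd R d] k := measurable_radial hK.
Let k0 : forall z, 0 <= k z := radial_ge0 hK.

Definition confinement (u : Rd R d -> R) : \bar R :=
  (\int[L]_x ((W (x : 'rV[R]_d))%:E * (u x)%:E))%E.

Let mWE : measurable_fun [set: Rd R d] (fun x : Rd R d => (W (x : 'rV[R]_d))%:E).
Proof. by apply/measurable_EFinP; exact: measurable_W hW. Qed.

Let mWu u : nnm u ->
  measurable_fun [set: Rd R d] (fun x : Rd R d => (W (x : 'rV[R]_d))%:E * (u x)%:E)%E.
Proof. by move=> [mu _]; apply: emeasurable_funM => //; exact/measurable_EFinP. Qed.

Let Wu0 u (x : Rd R d) : nnm u -> (0 <= (W (x : 'rV[R]_d))%:E * (u x)%:E)%E.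
Proof. by move=> [_ u0]; rewrite mule_ge0// lee_fin// (W_ge0 hW). Qed.

Lemma confinement_ge0 u : nnm u -> (0 <= confinement u)%E.
Proof. by move=> nu; apply: integral_ge0 => x _; exact: Wu0. Qed.

Lemma confinementD u v : nnm u -> nnm v ->
  confinement (u \+ v) = (confinement u + confinement v)%E.
Proof.
move=> nu nv; rewrite /confinement.
rewrite -(ge0_integralD L measurableT (fun x _ => Wu0 x nu) (mWu nu)
  (fun x _ => Wu0 x nv) (mWu nv)).
case: nu nv => _ u0 [_ v0].
by apply: eq_integral => x _; rewrite /= EFinD ge0_muleDr ?lee_fin.
Qed.

Lemma confinement_second_difference f u v : nnm f -> nnm u -> nnm v ->
  (confinement (f \+ (u \+ v))%R < +oo)%E ->
  exists w wu wv : R, [/\ confinement (f \+ (u \+ v))%R = w%:E,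
    confinement (f \+ (u \+ u))%R = wu%:E, confinement (f \+ (v \+ v))%R = wv%:E &
    wu + wv = 2 * w].
Proof.
move=> nf nu nv.
have nuv := nnmD nu nv; have nuu := nnmD nu nu; have nvv := nnmD nv nv.
rewrite !confinementD//.
move: (confinement f) (confinement u) (confinement v) (confinement_ge0 nf)
  (confinement_ge0 nu) (confinement_ge0 nv) => [a| |] [b| |] [c| |] //= _ _ _ _.
exists (a + (b + c)), (a + (b + b)), (a + (c + c)); split => //; ring.
Qed.

Lemma integral_W_confinement (m : probability (Rd R d) R) u : nnm u ->
  (forall A, measurable A -> m A = (\int[L]_(x in A) (u x)%:E)%E) ->
  (\int[m]_x (W x)%:E)%E = confinement u.
Proof.
move=> [mu u0] mE; rewrite (integral_density mu u0 mE mWE)//.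
by move=> x; rewrite lee_fin (W_ge0 hW).
Qed.

Lemma exists_competitor u : nnm u -> (forall x, u x <= rho) ->
  (\int[L]_x (u x)%:E = 1)%E -> (confinement u < +oo)%E ->
  exists2 m, P2r rho m & energy W K m = (confinement u - mutual k u u)%E.
Proof.
move=> nu urho u1 wu; have [mu u0] := nu.
have [nu0 nuE] := exists_density_measure L mu u0.
have nuT : nu0 setT = 1%E by rewrite nuE.
have [m mnu] := exists_probability nuT.
have mE A : measurable A -> m A = (\int[L]_(x in A) (u x)%:E)%E.
  by rewrite mnu; exact: nuE.
have bm : below rho m.
  move=> A mA; rewrite mE// -integral_cst//; apply: ge0_le_integral => //.
  - by move=> x _; rewrite lee_fin.
  - by apply: measurable_funTS; apply/measurable_EFinP.
  - by move=> x _; rewrite lee_fin.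
exists m.
  by apply: below_P2r => //; apply/(P2_integral_W hW); rewrite (integral_W_confinement nu mE).
by rewrite (energyE W hd hK bm) (interaction_mutual mk k0 nu mE) (integral_W_confinement nu mE).
Qed.

(** By hypothesis K(r) - K(t/2 + r) has a positive limit at 0+; for r < t/2 the
    subtracted value is at least K(t). *)
Lemma kernel_strict t : 0 < t -> exists2 r, 0 < r & kernel_on_pos K t < kernel_on_pos K r.
Proof.
move=> t0; have t20 : 0 < t / 2 by rewrite divr_gt0.
case: (hK) => _ _ _ /(_ _ t20)[l l0 Kl] _.
have near1 : \forall r \near (0 : R)^'+, (0 < (K r - K (t / 2 + r))%:E)%E.
  exact: (Kl _ (open_ereal_gt' l0)).
have near2 : \forall r \near (0 : R)^'+, r < t / 2 by exact: nbhs_right_lt.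
have near3 : \forall r \near (0 : R)^'+, 0 < r by exact: nbhs_right_gt.
have [r [[h1 h2] h3]] : exists r : R,
    ((0 < (K r - K (t / 2 + r))%:E)%E /\ r < t / 2) /\ 0 < r.
  by apply: (@filter_ex _ (0 : R)^'+); apply: filterI => //; exact: filterI.
exists r => //; move: h1; rewrite lte_fin subr_gt0.
have tr0 : 0 < t / 2 + r by rewrite addr_gt0.
have trt : t / 2 + r <= t by lra.
have := kernel_le hK tr0 trt; rewrite /kernel_on_pos tr0 t0 h3.
exact: le_lt_trans.
Qed.

(** Otherwise the two exchanges of mass would average to a decrease of the energy:
    the part linear in the density cancels, and the quadratic part contributes
    minus twice (self energies - mutual energies). *)
Lemma minimizer_bang_bang (m : probability (Rd R d) R) (g : Rd R d -> R) (del : R) :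
  is_minimizer rho W K m -> nnm g -> (forall x, g x <= rho) ->
  (forall A, measurable A -> m A = (\int[L]_(x in A) (g x)%:E)%E) ->
  0 < del -> L [set x | del <= g x <= rho - del] = 0%E.
Proof.
move=> [Pm minm] ng grho mE del0; set S := [set x | _].
have [mg g0] := ng.
have mS : measurable S.
  rewrite (_ : S = g @^-1` `[del, rho - del]%classic).
    by rewrite -[X in measurable X]setTI; exact: mg.
  by apply/seteqP; split => x /=; rewrite in_itv.
apply/eqP; rewrite eq_le measure_ge0 andbT leNgt; apply/negP => LS.
(* K r > K t, where r bounds the diameters of A and B, and t their distance from below *)
have [t [A1 [B1 [t0 [mA1 mB1] [A1S B1S] [LA1 LB1] AB1]]]] := separated_pieces hd mS LS.
have [r r0 Kr] := kernel_strict t0.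
have [A [a [mA AA1 a0 LA dA]]] := small_piece mA1 LA1 r0.
have [B [b [mB BB1 b0 LB dB]]] := small_piece mB1 LB1 r0.
have AS : A `<=` S by exact: subset_trans A1S.
have BS : B `<=` S by exact: subset_trans B1S.
have AB x : A x -> B x -> False.
  move=> /AA1 Ax /BB1 Bx; have := AB1 _ _ Ax Bx.
  by rewrite subrr enorm0 leNgt t0.
pose c1 := kernel_on_pos K r; pose c2 := kernel_on_pos K t.
have c20 : 0 <= c2 by exact: kernel_ge0 hK _.
have c10 : 0 <= c1 by exact: kernel_ge0 hK _.
have near_ge (C : set (Rd R d)) (x y : Rd R d) :
    (forall x y : Rd R d, C x -> C y -> enorm ((x : 'rV[R]_d) - y) <= r) ->
    C x -> C y -> x <> y -> c1 <= k ((x : 'rV[R]_d) - (y : 'rV[R]_d)).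
  move=> dC Cx Cy xy; apply: (kernel_le hK); last exact: dC.
  rewrite lt0r enorm_ge0 andbT; apply/eqP => /enorm_eq0/eqP.
  by rewrite subr_eq0 => /eqP.
have far_le (x y : Rd R d) : A x -> B y -> k ((x : 'rV[R]_d) - (y : 'rV[R]_d)) <= c2.
  by move=> /AA1 Ax /BB1 By; apply: (kernel_le hK) => //; exact: AB1.
have far_le' (x y : Rd R d) : B x -> A y -> k ((x : 'rV[R]_d) - (y : 'rV[R]_d)) <= c2.
  move=> /BB1 Bx /AA1 Ay; apply: (kernel_le hK) => //.
  by rewrite -enormN opprB; exact: AB1.
(* the heights s1 on A and s2 on B carry the same mass q = e a b; the choice of e
   makes both heights at most del *)
pose e := del / (a + b).
have ab0 : 0 < a + b by rewrite addr_gt0.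
have e0 : 0 < e by rewrite divr_gt0.
pose s1 := e * b; pose s2 := e * a.
have s10 : 0 < s1 by rewrite mulr_gt0.
have s20 : 0 < s2 by rewrite mulr_gt0.
have s1d : s1 <= del.
  by rewrite /s1 /e mulrAC ler_pdivrMr// ler_pM2l// lerDr ltW.
have s2d : s2 <= del.
  by rewrite /s2 /e mulrAC ler_pdivrMr// ler_pM2l// lerDl ltW.
pose q := e * a * b.
have q0 : 0 < q by apply: mulr_gt0 => //; exact: mulr_gt0.
pose p1 (x : Rd R d) : R := s1 * \1_A x; pose p2 (x : Rd R d) : R := s2 * \1_B x.
have n1 : nnm p1 by apply: nnm_indic => //; exact: ltW.
have n2 : nnm p2 by apply: nnm_indic => //; exact: ltW.
pose f x := g x - p1 x - p2 x.
have pb x : [/\ 0 <= f x, f x + (p1 x + p2 x) = g x,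
    f x + (p1 x + p1 x) <= rho & f x + (p2 x + p2 x) <= rho].
  rewrite /f /p1 /p2 !indicE; apply: (@perturbation_bounds _ rho del).
  - by rewrite g0 grho.
  - by rewrite s10 s1d.
  - by rewrite s20 s2d.
  - by apply/negP => /andP[/set_mem Ax /set_mem Bx]; exact: AB Ax Bx.
  - by move=> /orP[/set_mem/AS|/set_mem/BS].
have nf : nnm f.
  split => [|x]; last by have [] := pb x.
  by case: n1 => ? _; case: n2 => ? _; do 2 apply: measurable_funB => //.
have gE : g = (f \+ (p1 \+ p2))%R by apply/funext => x; have [] := pb x.
have u1rho x : (f \+ (p1 \+ p1))%R x <= rho by have [] := pb x.
have u2rho x : (f \+ (p2 \+ p2))%R x <= rho by have [] := pb x.
move: f nf gE u1rho u2rho {pb} => f nf gE u1rho u2rho.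
have n11 : nnm (p1 \+ p1)%R by exact: nnmD.
have n22 : nnm (p2 \+ p2)%R by exact: nnmD.
have n12 : nnm (p1 \+ p2)%R by exact: nnmD.
have nu1 : nnm (f \+ (p1 \+ p1))%R by exact: nnmD.
have nu2 : nnm (f \+ (p2 \+ p2))%R by exact: nnmD.
have intD u v : nnm u -> nnm v -> (\int[L]_x ((u \+ v)%R x)%:E =
    \int[L]_x (u x)%:E + \int[L]_x (v x)%:E)%E.
  move=> [mu u0] [mv v0]; rewrite -ge0_integralD//.
  - by move=> x _; rewrite lee_fin.
  - exact/measurable_EFinP.
  - by move=> x _; rewrite lee_fin.
  - exact/measurable_EFinP.
have int_ind s c (C : set (Rd R d)) : 0 <= s -> measurable C -> L C = c%:E ->
    (\int[L]_x (s * \1_C x)%:E = (s * c)%:E)%E.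
  move=> s0 mC LC; under eq_integral do rewrite EFinM.
  rewrite ge0_integralZl//; last by apply/measurable_EFinP; exact: measurable_indic.
  by rewrite integral_indic// setIT LC -EFinM.
have i1 : (\int[L]_x (p1 x)%:E = q%:E)%E.
  rewrite (int_ind s1 a A (ltW s10) mA LA); congr EFin; rewrite /s1 /q; ring.
have i2 : (\int[L]_x (p2 x)%:E = q%:E)%E.
  rewrite (int_ind s2 b B (ltW s20) mB LB); congr EFin; rewrite /s2 /q; ring.
have mass : (\int[L]_x (f x)%:E + (q%:E + q%:E) = 1)%E.
  have := probability_setT m; rewrite (mE _ measurableT) gE.
  by rewrite (intD _ _ nf n12) (intD _ _ n1 n2) i1 i2.
have mass1 : (\int[L]_x ((f \+ (p1 \+ p1))%R x)%:E = 1)%E.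
  by rewrite (intD _ _ nf n11) (intD _ _ n1 n1) i1.
have mass2 : (\int[L]_x ((f \+ (p2 \+ p2))%R x)%:E = 1)%E.
  by rewrite (intD _ _ nf n22) (intD _ _ n2 n2) i2.
have bm := P2r_below hrho Pm.
have energy_m : energy W K m = (confinement g - mutual k g g)%E.
  by rewrite (energyE W hd hK bm) (interaction_mutual mk k0 ng mE) (integral_W_confinement ng mE).
have wg : (confinement g < +oo)%E.
  by rewrite -(integral_W_confinement ng mE); apply/(P2_integral_W hW); case: Pm.
have Jg : (mutual k g g < +oo)%E.
  rewrite -(interaction_mutual mk k0 ng mE).
  by rewrite ltey_eq (interaction_fin_num hd hrho hK bm).
rewrite gE in energy_m wg Jg.
have [w [w1 [w2 [Wg W1 W2 Ww]]]] := confinement_second_difference nf n1 n2 wg.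
have [J [J1 [J2 [j11 [j12 [j21 [j22 [JgE JE1 JE2 [J11 J12 J21 J22] JJ]]]]]]]] :=
  mutual_second_difference mk k0 nf n1 n2 Jg.
have [m1 Pm1 Em1] := exists_competitor nu1 u1rho mass1 ltac:(by rewrite W1 ltry).
have [m2 Pm2 Em2] := exists_competitor nu2 u2rho mass2 ltac:(by rewrite W2 ltry).
have := minm _ Pm1; have := minm _ Pm2.
rewrite Em1 Em2 energy_m Wg W1 W2 JgE JE1 JE2 -!EFinB !lee_fin.
have h11 : c1 * q ^+ 2 <= j11.
  rewrite -lee_fin -J11; apply: le_trans (mutual_near_ge mk k0 hd mA LA (ltW s10) c10 _).
    by rewrite lee_fin /s1 /q le_eqVlt; apply/orP; left; apply/eqP; ring.
  by move=> x y; exact: (near_ge A x y dA).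
have h22 : c1 * q ^+ 2 <= j22.
  rewrite -lee_fin -J22; apply: le_trans (mutual_near_ge mk k0 hd mB LB (ltW s20) c10 _).
    by rewrite lee_fin /s2 /q le_eqVlt; apply/orP; left; apply/eqP; ring.
  by move=> x y; exact: (near_ge B x y dB).
have h12 : j12 <= c2 * q ^+ 2.
  rewrite -lee_fin -J12.
  apply: (le_trans (mutual_far_le mk k0 mA mB LA LB (ltW s10) (ltW s20) c20 far_le)).
  by rewrite lee_fin /s1 /s2 /q le_eqVlt; apply/orP; left; apply/eqP; ring.
have h21 : j21 <= c2 * q ^+ 2.
  rewrite -lee_fin -J21.
  apply: (le_trans (mutual_far_le mk k0 mB mA LB LA (ltW s20) (ltW s10) c20 far_le')).
  by rewrite lee_fin /s1 /s2 /q le_eqVlt; apply/orP; left; apply/eqP; ring.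
have : c2 * q ^+ 2 < c1 * q ^+ 2 by rewrite ltr_pM2r// exprn_gt0.
by move: (c1 * _) (c2 * _) h11 h22 h12 h21 Ww JJ; clear => x1 x2; lra.
Qed.

End BangBang.

(** * Reflected minimizers *)

Lemma exists_image_measure d1 d2 (X : measurableType d1) (Y : measurableType d2)
    (R : realType) (mu : {measure set X -> \bar R}) (phi : X -> Y) :
  measurable_fun [set: X] phi ->
  exists nu : {measure set Y -> \bar R}, forall A, nu A = mu (phi @^-1` A).
Proof.
move=> mphi; unshelve eexists (pushforward mu phi : {measure set Y -> \bar R}).
  exact: mphi.
by [].
Qed.

Section Conclusion.
Context (R : realType) (d : nat) (rho : R) (W : 'rV[R]_d -> R) (K : R -> R).
Hypotheses (hd : (0 < d)%N) (hrho : 0 < rho) (hW : condW W) (hK : condK d K).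
Local Notation L := (lebesgue_Rd R d).
Local Notation k := (@radial R d K).

(** The points where 0 < g < rho form a countable union of null sets. *)
Lemma minimizer_is_patch (m : probability (Rd R d) R) : is_minimizer rho W K m ->
  exists E : set (Rd R d), [/\ measurable E, L E = (rho^-1)%:E &
    has_density m (patch_density rho E)].
Proof.
move=> minm; have [Pm _] := minm.
have [g [mg g01 mE]] := P2r_density hrho Pm.
have ng : nonneg_measurable g by split => // x; have /andP[] := g01 x.
have grho x : g x <= rho by have /andP[] := g01 x.
pose E : set (Rd R d) := [set x | rho <= g x].
have mEE : measurable E.
  rewrite (_ : E = g @^-1` `[rho, +oo[%classic).
    by rewrite -[X in measurable X]setTI; exact: mg.
  by apply/seteqP; split => x /=; rewrite in_itv/= andbT.
pose S (n : nat) : set (Rd R d) := [set x | n.+1%:R^-1 <= g x <= rho - n.+1%:R^-1].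
have S0 n : L (S n) = 0%E.
  by apply: (minimizer_bang_bang hd hrho hW hK minm ng grho mE); rewrite invr_gt0.
have mS n : measurable (S n).
  rewrite (_ : S n = g @^-1` `[n.+1%:R^-1, rho - n.+1%:R^-1]%classic).
    by rewrite -[X in measurable X]setTI; exact: mg.
  by apply/seteqP; split => x /=; rewrite in_itv.
have patch_g : {ae L, forall x, patch_density rho E x = g x}.
  have : L.-negligible (\bigcup_n S n).
    by apply: negligible_bigcup => n; exists (S n); split; [exact: mS|exact: S0|].
  apply: negligibleS => x /= nx; apply: contrapT => Sx; apply: nx.
  rewrite /patch_density indicE; case: (boolP (x \in E)) => [/set_mem Ex|].
    by rewrite mulr1; apply/le_anti; rewrite grho andbT.
  rewrite notin_setE /E /= => /negP; rewrite -ltNge => xrho.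
  rewrite mulr0; apply/le_anti; have /andP[-> _] /= := g01 x.
  rewrite leNgt; apply/negP => gx; apply: Sx.
  pose e := Num.min (g x) (rho - g x).
  have e0 : 0 < e by rewrite lt_min gx subr_gt0.
  exists (Num.truncn e^-1) => //.
  have ne : (Num.truncn e^-1).+1%:R^-1 <= e.
    rewrite -[leRHS]invrK lef_pV2 ?posrE ?invr_gt0//.
    by rewrite ltW// truncnS_gt.
  have e1 : e <= g x by rewrite ge_min lexx.
  have e2 : e <= rho - g x by rewrite ge_min lexx orbT.
  rewrite /S /=; move: (_^-1) ne => q ne; apply/andP; split; lra.
exists E; split => //; last by exists g.
have : (\int[L]_x (patch_density rho E x)%:E = 1)%E.
  rewrite -(probability_setT m) (mE _ measurableT); apply: ae_eq_integral => //.
  - apply/measurable_EFinP; apply: measurable_funM => //; exact: measurable_indic.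
  - exact/measurable_EFinP.
  - by apply: filterS patch_g => x -> .
rewrite /patch_density; under eq_integral do rewrite EFinM.
rewrite ge0_integralZl//; last 2 first.
- by apply/measurable_EFinP; exact: measurable_indic.
- by rewrite lee_fin ltW.
rewrite integral_indic// setIT => h.
apply: (@mule_cancel R rho%:E) => //; first by rewrite h -EFinM divff// gt_eqF.
Qed.

Section Symmetry.
Variables (n : 'rV[R]_d) (c : R).
Hypotheses (n1 : enorm n = 1) (Wg : forall x, W (reflection n c x) = W x).
Local Notation g := (reflection n c : Rd R d -> Rd R d).

Lemma reflected_minimizer (m : probability (Rd R d) R) : is_minimizer rho W K m ->
  exists2 m' : probability (Rd R d) R, is_minimizer rho W K m' &
    forall A, m' A = m (g @^-1` A).
Proof.
move=> [Pm minm]; have mg := @measurable_reflection R d n c.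
have [nu nuE] := exists_image_measure m mg.
have nu1 : nu setT = 1%E by rewrite nuE preimage_setT; exact: (@probability_setT _ _ _ m).
have [m' m'nu] := exists_probability nu1.
have m'E A : m' A = m (g @^-1` A) by rewrite m'nu; exact: nuE.
have bm := P2r_below hrho Pm.
have bm' : below rho m'.
  move=> A mA; rewrite m'E -(lebesgue_Rd_reflection c n1 mA); apply: bm.
  by rewrite -[X in measurable X]setTI; exact: mg.
have im f mf f0 := integral_image mg (fun A _ => m'E A) (f := f) mf f0.
have WE : (\int[m']_x (W x)%:E = \int[m]_x (W x)%:E)%E.
  rewrite im; first by apply: eq_integral => x _; rewrite Wg.
    by apply/measurable_EFinP; exact: measurable_W hW.
  by move=> x; rewrite lee_fin (W_ge0 hW).
have Pm' : P2r rho m'.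
  apply: below_P2r => //; apply/(P2_integral_W hW); rewrite WE.
  by apply/(P2_integral_W hW); case: Pm.
have IE : interaction k m' = interaction k m.
  have mk := measurable_radial hK; have k0 := radial_ge0 hK.
  rewrite /interaction im.
  - apply: eq_integral => y _; rewrite im.
    + apply: eq_integral => x _; congr EFin.
      by rewrite /radial (reflection_isometry c n1).
    + exact: measurable_shifted_kernel.
    + by move=> x; rewrite lee_fin.
  - exact: measurable_potential.
  - by move=> y; apply: integral_ge0 => x _; rewrite lee_fin.
exists m' => //; split => // m'' Pm''.
by rewrite (energyE W hd hK bm') WE IE -(energyE W hd hK bm); exact: minm.
Qed.

(** The density of the image measure is f o g^-1, and g is its own inverse. *)
Lemma reflected_density (m m' : probability (Rd R d) R) (f : Rd R d -> R) :
  (forall A, m' A = m (g @^-1` A)) -> (forall x, 0 <= f x) ->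
  has_density m f -> has_density m' (f \o g).
Proof.
move=> m'E f0 [h [mh fh mE]]; have mg := @measurable_reflection R d n c.
have gK : involutive (reflection n c) by exact: reflectionK.
have mpre A : measurable A -> measurable (g @^-1` A).
  by move=> mA; rewrite -[X in measurable X]setTI; exact: mg.
pose h0 x := Num.max 0 (h x).
have mh0 : measurable_fun [set: Rd R d] h0 by exact: measurable_maxr.
have fh0 : {ae L, forall x, f x = h0 x}.
  by apply: filterS fh => x fhx; rewrite /h0 -fhx max_r.
have mE0 A : measurable A -> m A = (\int[L]_(x in A) (h0 x)%:E)%E.
  move=> mA; rewrite mE//; apply: ae_eq_integral => //.
  - by apply: measurable_funTS; exact/measurable_EFinP.
  - by apply: measurable_funTS; exact/measurable_EFinP.
  - by apply: filterS2 fh fh0 => x <- <-.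
exists (h0 \o g); split.
- exact: (measurableT_comp mh0 mg).
- have [N [mN LN fN]] := fh0; exists (g @^-1` N); split; first exact: mpre.
    by rewrite (lebesgue_Rd_reflection c n1 mN).
  by move=> x /= nx; apply: fN => /= fx; apply: nx.
move=> A mA; rewrite m'E mE0; last exact: mpre.
rewrite integral_mkcond [RHS]integral_mkcond.
rewrite [RHS](integral_image mg (nu := L)
  (fun A mA => esym (lebesgue_Rd_reflection c n1 mA))).
- by apply: eq_integral => x _; rewrite !patchE /= gK.
- apply/(measurable_restrictT _ mA)/measurable_funTS/measurable_EFinP.
  exact: (measurableT_comp mh0 mg).
- by move=> x; rewrite patchE; case: ifP => // _; rewrite lee_fin /h0 le_max lexx.
Qed.

Lemma patch_reflection (E : set (Rd R d)) :
  patch_density rho (g @` E) = patch_density rho E \o g.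
Proof.
apply/funext => x; rewrite /patch_density /= !indicE; congr (_ * _%:R).
congr (nat_of_bool _); apply/idP/idP; rewrite !inE.
  by move=> [y Ey <-]; rewrite (reflectionK c n1).
by move=> Ex; exists (g x) => //; rewrite (reflectionK c n1).
Qed.

End Symmetry.
End Conclusion.

Theorem theorem5p9 (R : realType) (d : nat) (rho : R)
    (W : 'rV[R]_d -> R) (K : R -> R) (gamma : 'rV[R]_d -> 'rV[R]_d)
    (hd : (0 < d)%N) (hrho : 0 < rho) (hW : condW W) (hK : condK d K)
    (hgamma : is_reflection gamma) (hWgamma : forall x, W (gamma x) = W x) :
  [/\ exists m : probability (Rd R d) R, is_minimizer rho W K m,
      forall m : probability (Rd R d) R, is_minimizer rho W K m ->
        exists E : set (Rd R d),
          [/\ measurable E, lebesgue_Rd R d E = (rho^-1)%:E &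
              has_density m (patch_density rho E)] &
      forall E : set (Rd R d),
        density_minimizer rho W K (patch_density rho E) ->
        density_minimizer rho W K (patch_density rho (gamma @` E))].
Proof.
split; first exact: exists_minimizer.
  by move=> m; exact: minimizer_is_patch.
case: hgamma hWgamma => n [c [n1 ->]] Wg E [m minm mE].
have [m' minm' m'E] := reflected_minimizer hd hrho hW hK n1 Wg minm.
exists m' => //; rewrite patch_reflection//.
apply: reflected_density m'E _ mE => // x.
by rewrite mulr_ge0// ltW.
Qed.
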